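(* Let $J(g)$ and $\widetilde J(\widetilde g)$ be two self-adjoint semi-infinite Jacobi operators with discrete spectrum, with coefficients $(a_n),(b_n)$ and $(\widetilde a_n),(\widetilde b_n)$ respectively, where $g,\widetilde g\in\mathbb{R}\cup\{\infty\}$. Let $h_1,h_2\in\mathbb{R}$, $h_1\neq h_2$. Write $\sigma(J_{h_1}(g))=\{\lambda_n\}_{n\in M}$, $\sigma(J_{h_2}(g))=\{\nu_n\}_{n\in M}$, $\sigma(\widetilde J_{h_1}(\widetilde g))=\{\widetilde\lambda_n\}_{n\in M}$, $\sigma(\widetilde J_{h_2}(\widetilde g))=\{\widetilde\nu_n\}_{n\in M}$, with the same index set $M\subset\mathbb{Z}$, each pair of spectra being enumerated according to the convention described in the context. Let $\{\gamma_n(h_1)\}_{n\in M}$ and $\{\widetilde\gamma_n(h_1)\}_{n\in M}$ be the norming constants corresponding to $J_{h_1}(g)$ and $\widetilde J_{h_1}(\widetilde g)$. Let $A\subset M$ be any subset, and suppose that $$\lambda_n=\widetilde\lambda_n\ (n\in M),\qquad \nu_n=\widetilde\nu_n\ (n\in M\setminus A),\qquad \gamma_n(h_1)=\widetilde\gamma_n(h_1)\ (n\in A).$$ Then $a_n=\widetilde a_n$ and $b_n=\widetilde b_n$ for all $n\in\mathbb{N}$, and, if $J_{min}\neq J_{min}^*$ (limit circle case), also $g=\widetilde g$. In other words, $\{\lambda_n\}_{n\in M}$, $\{\nu_n\}_{n\in M\setminus A}$, $\{\gamma_n(h_1)\}_{n\in A}$, $h_1$ and $h_2$ uniquely determine the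 operator $J(g)$ and, in the limit circle case, the boundary condition $g$ at infinity.
   Context: Jacobi operators. Given $a_n\in\mathbb{R}$, $b_n>0$ ($n\in\mathbb{N}=\{1,2,\dots\}$), let $(\tau f)_1=a_1f_1+b_1f_2$ and $(\tau f)_n=b_{n-1}f_{n-1}+a_nf_n+b_nf_{n+1}$ for $n\ge 2$. In $l^2(\mathbb{N})$ let $J_{min}$ be $\tau$ on the finitely supported sequences and $J_{max}=J_{min}^*$ be $\tau$ on $\{f\in l^2(\mathbb{N}):\tau f\in l^2(\mathbb{N})\}$. The limit point case is when $\overline{J_{min}}$ is self-adjoint; otherwise one is in the limit circle case (written $J_{min}\ne J_{min}^*$). In the limit point case put $J(g):=\overline{J_{min}}$ for every $g\in\mathbb{R}\cup\{\infty\}$. In the limit circle case let $c_0,s_0$ be the sequences satisfying $b_{n-1}u_{n-1}+a_nu_n+b_nu_{n+1}=0$ for $n\ge2$ with $c_0(1)=1,c_0(2)=0$, $s_0(1)=0,s_0(2)=1$; for $g=\cot\alpha$, $\alpha\in[0,\pi)$ (with $g=\infty$ for $\alpha=0$), put $v_\alpha=\cos(\alpha)c_0+\sin(\alpha)s_0$ and let $J(g)$ be the restriction of $J_{max}$ to $\{f\in\mathcal{D}(J_{max}):\lim_{n\to\infty}W_n(v_\alpha,f)=0\}$, where $W_n(f,k)=b_n(f(n)k(n+1)-k(n)f(n+1))$. These are all the self-adjoint extensions of $J_{min}$, and distinct $g$ give distinct extensions. For $h\in\mathbb{R}$, $J_h(g):=J(g)-h\langle\cdot,e_1\rangle e_1$,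 where $e_1$ is the first canonical basis vector; $h$ is called a boundary condition at the origin. ''Discrete spectrum'' means that the spectrum $\sigma(J(g))$ consists of isolated eigenvalues of finite multiplicity (then the same holds for every $J_h(g)$, and all eigenvalues are simple). The same notation with tildes is used for the operator with coefficients $\widetilde a_n,\widetilde b_n$. Norming constants. If $\lambda_k$ is an eigenvalue of $J_h(g)$ and $u$ is its eigenvector normalized by $u(1)=1$, then $\gamma_k(h)=\left(\sum_{n\in\mathbb{N}}|u(n)|^2\right)^{-1}$. Equivalently $-\gamma_k(h)$ is the residue at $\lambda_k$ of the Weyl $m$-function $m_h(z,g)=\langle e_1,(J_h(g)-z)^{-1}e_1\rangle$. Enumeration of two spectra. For $h_1\ne h_2$ the two spectra are disjoint, infinite and interlacing. Denote by $\{x_n\}_{n\in M}$ the spectrum for the larger of the two values $h_1,h_2$ and by $\{y_n\}_{n\in M}$ the spectrum for the smaller one (so if $h_1>h_2$ then $x_n=\lambda_n$, $y_n=\nu_n$, and if $h_1<h_2$ then $x_n=\nu_n$, $y_n=\lambda_n$). They are enumerated so that $x_n<y_n<x_{n+1}$ for $n\in M$ (whenever $n+1\in M$ for the last inequality), where: if $\inf x_n=-\infty$ and $\sup x_n=\infty$, then $M=\mathbb{Z}$ and $y_{-1}<0<x_1$; if $0<\sup x_n<\infty$, then $M=\{n\in\mathbb{Z}:n\le n_{max}\}$ with $n_{max}\ge1$ and $y_{-1}<0<x_1$; if $\sup x_n\le0$, then $M=\{n\in\mathbb{Z}:n\le0\}$; if $\inf y_n\ge0$, then $M=\{n\in\mathbb{Z}:n\ge0\}$;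 if $-\infty<\inf y_n<0$, then $M=\{n\in\mathbb{Z}:n\ge n_{min}\}$ with $n_{min}\le-1$ and $y_{-1}<0<x_1$. *)

(* Defs.v *)
From HB Require Import structures.
From mathcomp Require Import all_boot all_order all_algebra.
From mathcomp Require Import complex.
From mathcomp Require Import all_classical all_reals all_analysis.
Set Implicit Arguments.
Unset Strict Implicit.
Unset Printing Implicit Defensive.
Import Order.TTheory GRing.Theory Num.Theory.
Import numFieldNormedType.Exports.
Local Open Scope classical_set_scope.
Local Open Scope complex_scope.
Local Open Scope ring_scope.

(* Sequences (a_n), (b_n), (f_n), n = 1, 2, ..., are functions of type
   nat -> _ whose value at the natural number k is the term of index k+1. *)

Section Hilbert.
Context {R : realType}.
Implicit Types f k : nat -> R[i].

Definition cabs (z : R[i]) : R := Num.sqrt (complex.Re z ^+ 2 + complex.Im z ^+ 2).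

Lemma cabsE (z : R[i]) : (cabs z)%:C = `|z|.
Proof. by rewrite normc_def. Qed.

Definition sqnorm f : \bar R := (\sum_(0 <= n <oo) ((cabs (f n)) ^+ 2)%:E)%E.

Definition l2 f : Prop := (sqnorm f < +oo)%E.

(* Absolutely convergent when f and k are in l2; the limit is taken
   separately on real and imaginary parts. *)
Definition inner f k : R[i] :=
  (limn (series (fun n => complex.Re (f n * conjc (k n))))) +i*
  (limn (series (fun n => complex.Im (f n * conjc (k n))))).

(* An unbounded operator in l2 is given by its graph. *)
Definition l2_graph := set ((nat -> R[i]) * (nat -> R[i])).

Definition adjoint (T : l2_graph) : l2_graph :=
  [set p | [/\ l2 p.1, l2 p.2 &
     forall q, T q -> inner q.2 p.1 = inner q.1 p.2]].

Definition op_closure (T : l2_graph) : l2_graph :=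
  [set p | [/\ l2 p.1, l2 p.2 &
     forall e : R, 0 < e -> exists q, [/\ T q,
       (sqnorm (fun n => p.1 n - q.1 n)%R < e%:E)%E &
       (sqnorm (fun n => p.2 n - q.2 n)%R < e%:E)%E]]].

Definition selfadjoint (T : l2_graph) : Prop := adjoint T = T.

(* T - z is a bijection from its domain onto l2 with bounded inverse. *)
Definition resolvent_set (T : l2_graph) : set R[i] :=
  [set z | exists C : R, forall y, l2 y ->
     exists x, [/\ T (x, fun n => y n + z * x n),
       forall x', T (x', fun n => y n + z * x' n) -> x' = x &
       (sqnorm x <= C%:E * sqnorm y)%E]].

Definition spectrum (T : l2_graph) : set R[i] := ~` resolvent_set T.

Definition eigenspace (T : l2_graph) (z : R[i]) : set (nat -> R[i]) :=
  [set u | T (u, fun n => z * u n)].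

Definition eigenvalue (T : l2_graph) (z : R[i]) : Prop :=
  exists2 u, eigenspace T z u & exists n, u n != 0.

Definition finite_multiplicity (T : l2_graph) (z : R[i]) : Prop :=
  exists (d : nat) (e : 'I_d -> nat -> R[i]), forall u, eigenspace T z u ->
    exists c : 'I_d -> R[i], forall n, u n = \sum_(j < d) c j * e j n.

Definition isolated_in (S : set R[i]) (z : R[i]) : Prop :=
  exists2 e : R, 0 < e & forall w, S w -> cabs (w - z) < e -> w = z.

Definition discrete_spectrum (T : l2_graph) : Prop :=
  forall z, spectrum T z ->
    [/\ eigenvalue T z, isolated_in (spectrum T) z & finite_multiplicity T z].

End Hilbert.

Section Jacobi.
Context {R : realType}.
Implicit Types (a b : nat -> R) (g : option R) (h : R).

Definition tau a b (f : nat -> R[i]) : nat -> R[i] := fun n =>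
  match n with
  | 0%N => (a 0%N)%:C * f 0%N + (b 0%N)%:C * f 1%N
  | m.+1 => (b m)%:C * f m + (a m.+1)%:C * f m.+1 + (b m.+1)%:C * f m.+2
  end.

Definition finitely_supported (f : nat -> R[i]) : Prop :=
  exists N : nat, forall n, (N <= n)%N -> f n = 0.

Definition Jmin a b : l2_graph :=
  [set p | finitely_supported p.1 /\ p.2 = tau a b p.1].

Definition Jmax a b : l2_graph :=
  [set p | [/\ l2 p.1, l2 (tau a b p.1) & p.2 = tau a b p.1]].

Definition limit_point_case a b : Prop := selfadjoint (op_closure (Jmin a b)).

Definition limit_circle_case a b : Prop := ~ limit_point_case a b.

(* (u k, u k.+1) for the solution u, with u 0 = x and u 1 = y, of tau u = 0
   at every index but the first. *)
Fixpoint zero_sol_pair a b (x y : R) (k : nat) : R * R :=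
  match k with
  | 0%N => (x, y)
  | m.+1 => let: (p, q) := zero_sol_pair a b x y m in
            (q, - (b m * p + a m.+1 * q) / b m.+1)
  end.

Definition zero_sol a b (x y : R) (k : nat) : R := (zero_sol_pair a b x y k).1.

Lemma zero_solP a b x y (hb : forall n, 0 < b n) :
  let u := zero_sol a b x y in
  [/\ u 0%N = x, u 1%N = y &
      forall n, b n * u n + a n.+1 * u n.+1 + b n.+1 * u n.+2 = 0].
Proof.
split=> // n; rewrite /zero_sol /=.
case: (zero_sol_pair a b x y n) => p q /=.
by rewrite mulrCA divff ?gt_eqF// mulr1 subrr.
Qed.

Definition c0 a b : nat -> R := zero_sol a b 1 0.
Definition s0 a b : nat -> R := zero_sol a b 0 1.

Definition v_ a b (alpha : R) : nat -> R :=
  fun n => cos alpha * c0 a b n + sin alpha * s0 a b n.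

Definition wronskian b (f k : nat -> R[i]) (n : nat) : R[i] :=
  (b n)%:C * (f n * k n.+1 - k n * f n.+1).

(* g ranges over R with a point at infinity, represented by None;
   is_angle g alpha says that g = cot alpha with alpha in [0, pi). *)
Definition is_angle g (alpha : R) : Prop :=
  match g with
  | None => alpha = 0
  | Some r => 0 < alpha < pi /\ r = cos alpha / sin alpha
  end.

Definition Jg a b g : l2_graph :=
  [set p |
    (limit_point_case a b /\ op_closure (Jmin a b) p) \/
    [/\ limit_circle_case a b, Jmax a b p &
      exists2 alpha, is_angle g alpha &
        (fun n => cabs (wronskian b (fun j => (v_ a b alpha j)%:C) p.1 n))
          @ \oo --> (0 : R)]].

(* J(g) - h <., e_1> e_1 *)
Definition Jhg a b g h : l2_graph :=
  [set p | Jg a b g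
    (p.1, fun n : nat => p.2 n + (if n == 0%N then h%:C * p.1 0%N else 0))].

Definition norming_constant (T : l2_graph) (lam gamma : R) : Prop :=
  exists u, [/\ eigenspace T lam%:C u, u 0%N = 1 &
    gamma = (fine (sqnorm u))^-1].

Definition sup_on (M : set int) (x : int -> R) : \bar R :=
  ereal_sup [set (x n)%:E | n in M].
Definition inf_on (M : set int) (x : int -> R) : \bar R :=
  ereal_inf [set (x n)%:E | n in M].

Definition interlaced (M : set int) (x y : int -> R) : Prop :=
  (forall n, M n -> x n < y n) /\
  (forall n, M n -> M (n + 1) -> y n < x (n + 1)).

Definition enum_convention (M : set int) (x y : int -> R) : Prop :=
  let around0 := y (-1) < 0 /\ 0 < x 1 in
  interlaced M x y /\
  [/\ inf_on M x = -oo%E -> sup_on M x = +oo%E -> M = setT /\ around0,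
      (0 < sup_on M x < +oo)%E ->
        (exists2 nmax : int, 1 <= nmax & M = [set n | n <= nmax]) /\ around0,
      (sup_on M x <= 0)%E -> M = [set n | n <= 0],
      (0 <= inf_on M y)%E -> M = [set n | 0 <= n] &
      (-oo < inf_on M y < 0)%E ->
        (exists2 nmin : int, nmin <= -1 & M = [set n | nmin <= n]) /\ around0].

Definition enumerates_spectra a b g (h1 h2 : R) (M : set int)
    (lam nu : int -> R) : Prop :=
  [/\ spectrum (Jhg a b g h1) = [set (lam n)%:C | n in M],
      spectrum (Jhg a b g h2) = [set (nu n)%:C | n in M] &
      if h2 < h1 then enum_convention M lam nu else enum_convention M nu lam].

End Jacobi.

(* Main.v *)
(* Normalize the eigenvectors u_n of J_{h1}(g) by u_n(1) = 1.  A spectral gap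
   estimate on the orthogonal complement of finitely many of them gives the expansion
   x(k) = sum_n gamma_n u_n(k) <u_n, x>; in particular sum_n gamma_n = 1, and since
   J_{h2}(g) is a rank one perturbation, sum_n gamma_n / (lambda_n - nu_j) = 1/(h2 - h1)
   for all j.  Hence d_n = gamma_n - gamma~_n is supported on B = M \ A and satisfies
   sum_n d_n = 0 and sum_n d_n / (lambda_n - nu_j) = 0 for j in B.  By partial fractions
   sum_n d_n f(lambda_n) = 0 for every f(x) = prod_i (x - lambda_{k_i}) / (x - nu_{j_i})
   with k_i, j_i in B and distinct j_i.  Pairing the factors outward from n0, so that
   each nu_{j_i} separates lambda_{k_i} from lambda_{n0}, and dividing by f(lambda_{n0}),
   one gets 0 <= f <= 1 at the lambda_n outside a large window, f = 0 inside it except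
   at n0, and f = 1 at n0; so |d_{n0}| is at most the tail of sum |d_n|, i.e. d = 0.
   The coefficients are then read off from the orthonormality of the polynomials u_n(k),
   and in the limit circle case the resolvents of J(g) and J(g~) agree, so g = g~.
   All spectral arguments take place at real points, on real sequences. *)
Require Import Defs.
From mathcomp Require Import all_boot all_order all_algebra.
From mathcomp Require Import complex.
From mathcomp Require Import all_classical all_reals all_analysis.
From mathcomp Require Import ring lra zify.
Import Order.TTheory GRing.Theory Num.Theory.
Import numFieldNormedType.Exports.
Local Open Scope classical_set_scope.
Local Open Scope ring_scope.

Set Implicit Arguments.
Unset Strict Implicit.
Unset Printing Implicit Defensive.

(** * Square-summable real sequences *)

(** No spectral theorem is invoked. The gap estimate needs only symmetry, surjectivity at one real
    point and a lower bound for [T - s] at each real [s] in an interval, all read off from the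
    prescribed spectra. At [s = lam n] the operator with [h1] has a kernel, and the lower bound off
    [u n] comes from the operator with [h2], for which [lam n] is a resolvent point. Symmetry of
    [J(g)] is not part of its definition. In the limit circle case it requires convergent Wronskians
    with [v_alpha], hence square summable solutions, whereas the case is defined only by failure of
    self-adjointness. A minimization in graph norm turns that failure into a pair in the maximal
    domain with nonzero boundary form, and Weyl's argument then gives [c0] and [s0] in l2. In the
    uniqueness step nothing is known about the decay of [d] beyond absolute summability, so the test
    functions must be bounded by a constant independent of the window. This forces the pairing of
    zeros with separating poles. *)

Section SquareSummable.
Context {R : realType}.
Implicit Types x y z : nat -> R.

Definition sums (f : nat -> R) (l : R) : Prop := series f @ \oo --> l.

Lemma sums_unique f l l' : sums f l -> sums f l' -> l = l'.
Proof. by move=> h h'; apply: (cvg_unique _ h h'). Qed.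

Lemma sumsD f k l m : sums f l -> sums k m ->
  sums (fun n => f n + k n) (l + m).
Proof.
move=> fl km; rewrite /sums (_ : series _ = series f + series k); last first.
  by rewrite -seriesD.
exact: cvgD fl km.
Qed.

Lemma sumsZ t f l : sums f l -> sums (fun n => t * f n) (t * l).
Proof.
move=> fl; rewrite /sums (_ : series _ = t *: series f); last first.
  by rewrite -seriesZ.
exact: cvgZr.
Qed.

Arguments sumsZ t {f l} _.

Lemma sumsB f k l m : sums f l -> sums k m ->
  sums (fun n => f n - k n) (l - m).
Proof.
move=> fl km.
have := sumsD fl (sumsZ (-1) km); rewrite mulN1r.
by congr (sums _ _); apply/funext => n; rewrite mulN1r.
Qed.

Lemma sums_fin f N : (forall n, (N <= n)%N -> f n = 0) ->
  sums f (\sum_(0 <= i < N) f i).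
Proof.
move=> f0; apply: cvg_near_cst; exists N => // n /= Nn.
rewrite /series /= (@big_cat_nat _ _ _ N)//= [X in _ + X]big_nat_cond.
rewrite [X in _ + X]big1 ?addr0//.
by move=> i /andP[/andP[Ni _] _]; exact: f0.
Qed.

Lemma sums_ge0_le f l N : (forall n, 0 <= f n) -> sums f l ->
  \sum_(0 <= i < N) f i <= l.
Proof.
move=> f0 fl; rewrite -(cvg_lim (@Rhausdorff R) fl).
apply: nondecreasing_cvgn_le; last by apply/cvg_ex; exists l.
by apply: nondecreasing_series => n _ _; exact: f0.
Qed.

Lemma bounded_sums f C : (forall n, 0 <= f n) ->
  (forall N, \sum_(0 <= i < N) f i <= C) -> exists2 l, sums f l & l <= C.
Proof.
move=> f0 fC; have cf : cvgn (series f).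
  apply: nondecreasing_is_cvgn.
    by apply: nondecreasing_series => n _ _; exact: f0.
  by exists C => _ [N _ <-]; exact: fC.
exists (limn (series f)) => //; apply: limr_le => //.
by apply: nearW => N; exact: fC.
Qed.

Lemma sums_tail f l (e : R) : sums f l -> 0 < e ->
  exists N, forall P, (N <= P)%N -> `|\sum_(N <= i < P) f i| < e.
Proof.
move=> fl e0; have e20 : 0 < e / 2 by rewrite divr_gt0.
have /cvgrPdist_lt/(_ _ e20)[N _ hN] := fl.
exists N => P NP; rewrite -sub_series_geq//.
have := hN N (leqnn N); have := hN P NP; rewrite /= => h1 h2.
rewrite (_ : _ - _ = (l - series f N) - (l - series f P)); last by ring.
by rewrite (le_lt_trans (ler_normB _ _))// (splitr e) ltrD.
Qed.

Definition l2r x : Prop := exists l, sums (fun n => x n ^+ 2) l.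

Definition dot x y : R := limn (series (fun n => x n * y n)).

Lemma bounded_l2r x C : (forall N, \sum_(0 <= i < N) x i ^+ 2 <= C) -> l2r x.
Proof.
by move=> /(bounded_sums (fun n => sqr_ge0 (x n)))[l xl _]; exists l.
Qed.

Lemma dotP x y : l2r x -> l2r y -> sums (fun n => x n * y n) (dot x y).
Proof.
move=> [l xl] [m ym].
suff : cvgn (series (fun n => x n * y n)) by [].
apply: normed_cvg; apply: (@series_le_cvg _ _ (fun n => x n ^+ 2 + y n ^+ 2)).
- by move=> n; exact: normr_ge0.
- by move=> n; rewrite addr_ge0// sqr_ge0.
- move=> n /=; rewrite ler_norml; have := sqr_ge0 (x n + y n).
  have := sqr_ge0 (x n - y n); have := sqr_ge0 (x n); have := sqr_ge0 (y n).
  by move=> *; apply/andP; split; lra.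
- by apply/cvg_ex; exists (l + m); exact: sumsD.
Qed.

Lemma dot_sums x y l : sums (fun n => x n * y n) l -> dot x y = l.
Proof. by move=> h; exact: (cvg_lim (@Rhausdorff R) h). Qed.

Lemma l2rD x y : l2r x -> l2r y -> l2r (x + y).
Proof.
move=> lx ly; move: (lx) (ly) => [l xl] [m ym].
exists (l + m + 2 * dot x y).
have := sumsD (sumsD xl ym) (sumsZ 2 (dotP lx ly)).
congr (sums _ _); apply/funext => n /=; rewrite fctE /=; ring.
Qed.

Lemma l2rZ t x : l2r x -> l2r (t *: x).
Proof.
move=> [l xl]; exists (t ^+ 2 * l); have := sumsZ (t ^+ 2) xl.
by congr (sums _ _); apply/funext => n /=; rewrite -exprMn.
Qed.

Lemma l2rB x y : l2r x -> l2r y -> l2r (x - y).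
Proof. by move=> lx ly; rewrite -scaleN1r; exact/l2rD/l2rZ. Qed.

Lemma l2r_fin x N : (forall n, (N <= n)%N -> x n = 0) -> l2r x.
Proof.
move=> x0; eexists; apply: (@sums_fin _ N) => n /x0 ->; by rewrite expr0n.
Qed.

Lemma l2r0 : l2r 0. Proof. exact: (@l2r_fin _ 0). Qed.

Lemma dotC x y : dot x y = dot y x.
Proof. by congr (limn (series _)); apply/funext => n; rewrite mulrC. Qed.

Lemma dotDl x y z : l2r x -> l2r y -> l2r z ->
  dot (x + y) z = dot x z + dot y z.
Proof.
move=> lx ly lz; apply: dot_sums; have := sumsD (dotP lx lz) (dotP ly lz).
by congr (sums _ _); apply/funext => n; rewrite fctE mulrDl.
Qed.

Lemma dotZl t x z : l2r x -> l2r z -> dot (t *: x) z = t * dot x z.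
Proof.
move=> lx lz; apply: dot_sums; have := sumsZ t (dotP lx lz).
by congr (sums _ _); apply/funext => n; rewrite mulrA.
Qed.

Lemma dotBl x y z : l2r x -> l2r y -> l2r z ->
  dot (x - y) z = dot x z - dot y z.
Proof.
move=> lx ly lz; rewrite -scaleN1r dotDl ?dotZl ?mulN1r//; exact: l2rZ.
Qed.

Lemma dotDr x y z : l2r x -> l2r y -> l2r z ->
  dot z (x + y) = dot z x + dot z y.
Proof. by move=> *; rewrite dotC dotDl// !(dotC z). Qed.

Lemma dotZr t x z : l2r x -> l2r z -> dot z (t *: x) = t * dot z x.
Proof. by move=> *; rewrite dotC dotZl// (dotC z). Qed.

Lemma dotBr x y z : l2r x -> l2r y -> l2r z ->
  dot z (x - y) = dot z x - dot z y.
Proof. by move=> *; rewrite dotC dotBl// !(dotC z). Qed.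

Definition nrm2 x : R := dot x x.

Lemma nrm2P x : l2r x -> sums (fun n => x n ^+ 2) (nrm2 x).
Proof. by move=> lx; exact: dotP. Qed.

Lemma nrm2_le x N : l2r x -> \sum_(0 <= i < N) x i ^+ 2 <= nrm2 x.
Proof. by move=> lx; apply: sums_ge0_le (nrm2P lx) => n; exact: sqr_ge0. Qed.

Lemma nrm2_ge0 x : l2r x -> 0 <= nrm2 x.
Proof. by move=> lx; have := nrm2_le 0 lx; rewrite big_geq. Qed.

Lemma nrm2_bound x C : (forall N, \sum_(0 <= i < N) x i ^+ 2 <= C) ->
  nrm2 x <= C.
Proof.
move=> /(bounded_sums (fun n => sqr_ge0 (x n)))[l xl lC].
by rewrite /nrm2 (dot_sums xl).
Qed.

Lemma coord_le x k : l2r x -> x k ^+ 2 <= nrm2 x.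
Proof.
move=> lx; apply: le_trans (nrm2_le k.+1 lx).
by rewrite big_nat_recr//= lerDr sumr_ge0// => i _; exact: sqr_ge0.
Qed.

Lemma nrm2_gt0 x k : l2r x -> x k != 0 -> 0 < nrm2 x.
Proof.
by move=> lx xk; apply: lt_le_trans (coord_le k lx); rewrite exprn_even_gt0.
Qed.

Lemma nrm2_eq0 x : l2r x -> nrm2 x <= 0 -> x = 0.
Proof.
move=> lx x0; apply/funext => k; apply/eqP; rewrite -sqrf_eq0.
by rewrite eq_le sqr_ge0 (le_trans (coord_le k lx) x0).
Qed.

Lemma nrm2Z t x : l2r x -> nrm2 (t *: x) = t ^+ 2 * nrm2 x.
Proof.
by move=> lx; rewrite /nrm2 dotZl ?dotZr ?mulrA ?expr2//; exact: l2rZ.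
Qed.

Lemma nrm20 : nrm2 0 = 0.
Proof. by rewrite -(scale0r 0) nrm2Z ?expr0n ?mul0r//; exact: l2r0. Qed.

Lemma nrm2D x y : l2r x -> l2r y ->
  nrm2 (x + y) = nrm2 x + 2 * dot x y + nrm2 y.
Proof.
move=> lx ly; have lxy := l2rD lx ly.
rewrite /nrm2 dotDl// !dotDr// (dotC y x); ring.
Qed.

Lemma nrm2B x y : l2r x -> l2r y ->
  nrm2 (x - y) = nrm2 x - 2 * dot x y + nrm2 y.
Proof.
move=> lx ly; rewrite -scaleN1r nrm2D ?nrm2Z ?dotZr//; last exact: l2rZ.
by ring.
Qed.

Lemma nrm2D_le x y : l2r x -> l2r y -> nrm2 (x + y) <= 2 * nrm2 x + 2 * nrm2 y.
Proof.
move=> lx ly; have := nrm2_ge0 (l2rB lx ly); rewrite nrm2B// nrm2D//; lra.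
Qed.

Lemma nrm2B_le x y : l2r x -> l2r y -> nrm2 (x - y) <= 2 * nrm2 x + 2 * nrm2 y.
Proof.
move=> lx ly; have := nrm2_ge0 (l2rD lx ly); rewrite nrm2B// nrm2D//; lra.
Qed.

Lemma cauchy_schwarz x y : l2r x -> l2r y ->
  dot x y ^+ 2 <= nrm2 x * nrm2 y.
Proof.
move=> lx ly; have := nrm2_ge0 lx; rewrite le_eqVlt => /predU1P[x0|x0].
  have -> : x = 0 by apply: nrm2_eq0; rewrite -?x0.
  rewrite -(scale0r x) dotZl// mul0r expr0n /= mulr_ge0 ?nrm2_ge0//.
  exact: l2rZ.
have := nrm2_ge0 (l2rB (l2rZ (nrm2 x) ly) (l2rZ (dot x y) lx)).
rewrite nrm2B ?nrm2Z ?dotZl ?dotZr//; try exact: l2rZ.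
rewrite (dotC y x) => h.
have {}h : 0 <= nrm2 x * (nrm2 x * nrm2 y - dot x y ^+ 2).
  by move: h; congr (_ <= _); ring.
by move: h; rewrite pmulr_rge0// subr_ge0.
Qed.

Definition basis (k : nat) : nat -> R := fun n => (n == k)%:R.

Lemma basis_fin k n : (k < n)%N -> basis k n = 0.
Proof. by rewrite /basis => kn; rewrite gtn_eqF. Qed.

Lemma l2r_basis k : l2r (basis k).
Proof. by apply: (@l2r_fin _ k.+1) => n; exact: basis_fin. Qed.

Lemma dot_basis k x : dot (basis k) x = x k.
Proof.
have h : sums (fun n => basis k n * x n) (\sum_(0 <= i < k.+1) basis k i * x i).
  by apply: sums_fin => n kn; rewrite basis_fin ?mul0r.
rewrite (dot_sums h) big_nat_recr//= big_nat_cond big1 ?add0r.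
  by rewrite /basis eqxx mul1r.
by move=> i /andP[/andP[_ ik] _]; rewrite /basis ltn_eqF// mul0r.
Qed.

End SquareSummable.
Arguments sumsZ {R} t {f l} _.

(** * Symmetric operators with a spectral gap *)

Section SpectralGap.
Context {R : realType}.
Implicit Types (x y z : nat -> R) (T : (nat -> R) -> (nat -> R) -> Prop).

Definition lin_graph T : Prop := forall t x y x' y',
  T x y -> T x' y' -> T (x + t *: x') (y + t *: y').

Definition sym_graph T : Prop := forall x y x' y',
  T x y -> T x' y' -> dot y x' = dot x y'.

Definition l2_dom T : Prop := forall x y, T x y -> l2r x /\ l2r y.

(** A bounded symmetric operator has its norm or its opposite as an approximate eigenvalue. Applied
    to [B = T^-1] on [V], this says that [1 / |B|] or [- 1 / |B|] is an approximate eigenvalue of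
    [T]; since there is none in []-r, r[], [|B| <= 1 / r]. *)
Lemma spectral_gap T (V : set (nat -> R)) (r : R) :
  lin_graph T -> sym_graph T -> l2_dom T ->
  (forall t x y, V x -> V y -> V (x + t *: y)) ->
  (forall y, V y -> exists2 x, V x & T x y) ->
  (forall s, `|s| < r -> exists C, forall x y, V x -> V y -> T x y ->
     nrm2 x <= C * nrm2 (y - s *: x)) ->
  0 < r ->
  forall x y, V x -> V y -> T x y -> r ^+ 2 * nrm2 x <= nrm2 y.
Proof.
move=> lin sym dom Vlin onto bnd r0 x0 y0 Vx0 Vy0 Txy0.
have {}bnd s : `|s| < r -> exists2 C, 0 <= C & forall x y, V x -> V y ->
    T x y -> nrm2 x <= C * nrm2 (y - s *: x).
  move=> /bnd[C hC]; exists `|C|; first exact: normr_ge0.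
  move=> x y Vx Vy Txy; apply: le_trans (hC _ _ Vx Vy Txy) _.
  have [lx ly] := dom _ _ Txy.
  by rewrite ler_wpM2r ?ler_norm ?nrm2_ge0//; apply: l2rB => //; exact: l2rZ.
(* The supremum [m] of [S] is the squared norm of [B = T^-1] on [V]. *)
pose S := [set q | exists x y, [/\ V x, V y, T x y, nrm2 y <= 1 & q = nrm2 x]].
have [C0 C00 hC0] : exists2 C, 0 <= C & forall x y, V x -> V y ->
    T x y -> nrm2 x <= C * nrm2 y.
  have [|C C0 hC] := bnd 0; first by rewrite normr0.
  by exists C => // x y Vx Vy Txy; have := hC _ _ Vx Vy Txy; rewrite scale0r subr0.
have ubS : ubound S C0.
  move=> _ [x [y [Vx Vy Txy y1 ->]]]; apply: le_trans (hC0 _ _ Vx Vy Txy) _.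
  by rewrite ler_piMr.
have supS q : S q -> q <= sup S by apply: ub_le_sup; exists C0.
set m := sup S in supS.
have hm x y : V x -> V y -> T x y -> nrm2 x <= m * nrm2 y.
  move=> Vx Vy Txy; have [lx ly] := dom _ _ Txy.
  have [y_le0|y_gt0] := lerP (nrm2 y) 0.
    have y00 : nrm2 y = 0 by apply/eqP; rewrite eq_le y_le0 nrm2_ge0.
    by have := hC0 _ _ Vx Vy Txy; rewrite y00 !mulr0.
  pose t := (Num.sqrt (nrm2 y))^-1.
  have t2 : t ^+ 2 = (nrm2 y)^-1 by rewrite exprVn sqr_sqrtr// ltW.
  have := lin (t - 1) _ _ _ _ Txy Txy.
  have e z : z + (t - 1) *: z = t *: z by rewrite scalerBl scale1r addrC subrK.
  rewrite !e => Tt.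
  have : nrm2 (t *: x) <= m.
    apply: supS; exists (t *: x), (t *: y); split => //.
    - by rewrite -e; exact: Vlin.
    - by rewrite -e; exact: Vlin.
    - by rewrite nrm2Z// t2 mulVf// gt_eqF.
  by rewrite nrm2Z// t2 mulrC ler_pdivrMr.
rewrite leNgt; apply/negP => hlt.
have [lx0 ly0] := dom _ _ Txy0.
have x0_gt0 : 0 < nrm2 x0.
  have := nrm2_ge0 ly0 => y_ge0; have := le_lt_trans y_ge0 hlt.
  by rewrite pmulr_rgt0// exprn_gt0.
have y0_gt0 : 0 < nrm2 y0.
  rewrite lt_neqAle nrm2_ge0// andbT; apply/negP => /eqP y00.
  by have := hC0 _ _ Vx0 Vy0 Txy0; rewrite -y00 mulr0 leNgt x0_gt0.
have hm0 := hm _ _ Vx0 Vy0 Txy0.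
have m_gt0 : 0 < m by rewrite -(pmulr_lgt0 _ y0_gt0) (lt_le_trans x0_gt0).
(* Were the estimate false at [x0], then [r ^+ 2 * m > 1], so [s = 1 / sqrt m] satisfies [s < r] and
   [T] is bounded below after a shift by either [s] or [- s]. *)
pose be := Num.sqrt m.
have be2 : be ^+ 2 = m by rewrite sqr_sqrtr// ltW.
have be_gt0 : 0 < be by rewrite sqrtr_gt0.
pose s := be^-1.
have sbe : s * be = 1 by rewrite mulVf// gt_eqF.
have s_gt0 : 0 < s by rewrite invr_gt0.
have rm : 1 < r ^+ 2 * m.
  have : nrm2 y0 * 1 < nrm2 y0 * (r ^+ 2 * m).
    rewrite mulr1 (lt_le_trans hlt)//.
    rewrite (_ : nrm2 y0 * _ = r ^+ 2 * (m * nrm2 y0)); last by ring.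
    by rewrite ler_pM2l// exprn_gt0.
  by rewrite ltr_pM2l.
have sr : s < r.
  have rbe : 1 < r * be.
    rewrite -(@ltr_pXn2r _ 2) ?nnegrE ?mulr_ge0// ?ltW// exprMn be2 expr1n//.
  by rewrite /s invf_plt ?posrE// -(ltr_pM2l r0) divff ?gt_eqF.
have [|C1 C10 hC1] := bnd s; first by rewrite ger0_norm// ltW.
have [|C2 C20 hC2] := bnd (- s); first by rewrite normrN ger0_norm// ltW.
pose K1 := 2 * s ^+ 2 * (C1 * s ^+ 2 + 1).
pose K2 := 2 * s ^+ 2 * (C2 * s ^+ 2 + 1).
have s2_gt0 : 0 < s ^+ 2 by rewrite exprn_gt0.
have K1_gt0 : 0 < K1.
  by rewrite !mulr_gt0// ltr_wpDl// mulr_ge0// ltW.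
have K2_gt0 : 0 < K2.
  by rewrite !mulr_gt0// ltr_wpDl// mulr_ge0// ltW.
(* [B = T^-1] satisfies [B^2 - m = (B - be) (B + be)], so [B^2 - m] is bounded
   below, while [|(B^2 - m) y|^2 <= m (m |y|^2 - |B y|^2)]. *)
have key x y : V x -> V y -> T x y ->
    nrm2 y <= K1 * K2 * (m ^+ 2 * nrm2 y - m * nrm2 x).
  move=> Vx Vy Txy; have [z Vz Tzx] := onto _ Vx.
  have [lx ly] := dom _ _ Txy; have [lz _] := dom _ _ Tzx.
  pose w := z - m *: y; pose p := x + be *: y; pose q := z + be *: x.
  have lw : l2r w by apply: l2rB => //; exact: l2rZ.
  have lp : l2r p by apply: l2rD => //; exact: l2rZ.
  have lq : l2r q by apply: l2rD => //; exact: l2rZ.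
  have Tqp : T q p by exact: lin.
  have Vq : V q by exact: Vlin.
  have Vp : V p by exact: Vlin.
  have e1 : p - s *: q = (- s) *: w.
    by apply/funext => i; rewrite /p /q /w -be2 !fctE /GRing.scale /=; ring: sbe.
  have h1 : nrm2 q <= C1 * s ^+ 2 * nrm2 w.
    by have := hC1 _ _ Vq Vp Tqp; rewrite e1 nrm2Z// sqrrN mulrA.
  have h2 : nrm2 p <= K1 * nrm2 w.
    have -> : p = s *: q - s *: w.
      by apply/eqP; rewrite -subr_eq0 opprB addrA addrAC e1 scaleNr addNr.
    apply: le_trans (nrm2B_le (l2rZ _ lq) (l2rZ _ lw)) _.
    by rewrite !nrm2Z// /K1; have := ler_wpM2l (ltW s2_gt0) h1; lra.
  have e2 : y - (- s) *: x = s *: p.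
    by rewrite scaleNr opprK /p scalerDr scalerA sbe scale1r addrC.
  have h3 : nrm2 x <= C2 * s ^+ 2 * nrm2 p.
    by have := hC2 _ _ Vx Vy Txy; rewrite e2 nrm2Z// mulrA.
  have h4 : nrm2 y <= K2 * nrm2 p.
    have -> : y = s *: p - s *: x by rewrite -e2 scaleNr opprK addrK.
    apply: le_trans (nrm2B_le (l2rZ _ lp) (l2rZ _ lx)) _.
    by rewrite !nrm2Z// /K2; have := ler_wpM2l (ltW s2_gt0) h3; lra.
  have h5 : nrm2 w <= m ^+ 2 * nrm2 y - m * nrm2 x.
    rewrite /w nrm2B//; last exact: l2rZ.
    rewrite nrm2Z// dotZr//.
    rewrite -(sym _ _ _ _ Tzx Txy) -/(nrm2 x).
    have := hm _ _ Vz Vx Tzx; lra.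
  rewrite (mulrC K1) -mulrA (le_trans h4)// ler_pM2l// (le_trans h2)//.
  by rewrite ler_pM2l.
set K := K1 * K2 in key.
have K_gt0 : 0 < K by exact: mulr_gt0.
(* Combining [key] with [nrm2 x <= m * nrm2 y] yields [nrm2 x * D <= m * nrm2 y], so [m / D] is a
   smaller upper bound of [S] than its supremum. *)
pose D := 1 + (K * m ^+ 2)^-1.
have D_gt1 : 1 < D by rewrite ltrDl invr_gt0 mulr_gt0// exprn_gt0.
have D_gt0 : 0 < D by exact: lt_trans D_gt1.
suff : m <= m / D by rewrite ler_pdivlMr// ger_pMr// leNgt D_gt1.
have V0 : V 0 by have := Vlin (-1) _ _ Vx0 Vx0; rewrite scaleN1r subrr.
have T0 : T 0 0 by have := lin (-1) _ _ _ _ Txy0 Txy0; rewrite !scaleN1r !subrr.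
apply: ge_sup.
  by exists (nrm2 (0 : nat -> R)), 0, 0; split; rewrite ?nrm20 ?ler01.
move=> _ [x [y [Vx Vy Txy y1 ->]]].
have [lx ly] := dom _ _ Txy.
have h1 := key _ _ Vx Vy Txy; have h2 := hm _ _ Vx Vy Txy.
rewrite ler_pdivlMr// /D mulrDr mulr1.
have h3 : nrm2 x / (K * m ^+ 2) <= m * nrm2 y - nrm2 x.
  rewrite ler_pdivrMr; last by rewrite mulr_gt0// exprn_gt0.
  apply: (le_trans h2); rewrite (_ : _ * (K * _) =
    m * (K * (m ^+ 2 * nrm2 y - m * nrm2 x))); last by ring.
  by rewrite ler_pM2l.
by move: h3; rewrite lerBrDl => /le_trans; apply; rewrite ger_pMr.
Qed.

End SpectralGap.

(** * A uniqueness theorem for interlacing poles and zeros *)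

Ltac nonzero := repeat (apply/andP; split); apply/eqP => ?; lra.

Section InterlacingUniqueness.
Context {R : realType}.

(** Indices at which [e] is [None] contribute 0. The enumeration is a parameter because the
    reflected version of the uniqueness theorem sums along the negated one. *)
Definition sums_along {I : Type} (e : nat -> option I) (f : I -> R) (l : R) : Prop :=
  sums (fun i => oapp f 0 (e i)) l.

Section IndexedSums.
Context {I : Type} (e : nat -> option I).
Implicit Types (f k : I -> R).
Local Notation isums := (sums_along e).

Lemma isumsD f k l m : isums f l -> isums k m ->
  isums (fun n => f n + k n) (l + m).
Proof.
move=> fl km; have := sumsD fl km; congr (sums _ _).
by apply/funext => i; case: (e i) => [n|] //=; rewrite addr0.
Qed.

Lemma isumsZ t f l : isums f l -> isums (fun n => t * f n) (t * l).
Proof.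
move=> fl; have := sumsZ t fl; congr (sums _ _).
by apply/funext => i; case: (e i) => [n|] //=; rewrite mulr0.
Qed.

Lemma isumsB f k l m : isums f l -> isums k m ->
  isums (fun n => f n - k n) (l - m).
Proof.
move=> fl km; have := sumsB fl km; congr (sums _ _).
by apply/funext => i; case: (e i) => [n|] //=; rewrite subr0.
Qed.

Lemma eq_isums f k l : f =1 k -> isums f l -> isums k l.
Proof. by move=> /funext ->. Qed.

Lemma isums_unique f l l' : isums f l -> isums f l' -> l = l'.
Proof. exact: sums_unique. Qed.

End IndexedSums.
Arguments isumsZ {I e} t {f l} _.

Variables (enum : nat -> option int) (rank : int -> nat).
Hypothesis enumK : ocancel enum rank.
Hypothesis rankK : pcancel rank enum.
Local Notation isums := (sums_along enum).
Variables (M B : set int) (l nu d g : int -> R) (G : R).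
Hypothesis BM : B `<=` M.
Hypothesis l_lt_nu : forall m n, M m -> M n -> m <= n -> l m < nu n.
Hypothesis nu_lt_l : forall m n, M m -> M n -> m < n -> nu m < l n.
Hypothesis d0 : forall n, ~ B n -> d n = 0.
Hypothesis d_le : forall n, `|d n| <= g n.
Hypothesis g_sum : isums g G.
Hypothesis d_sum : isums d 0.
Hypothesis d_nu : forall j, B j -> isums (fun n => d n / (l n - nu j)) 0.

Let l_lt m n : M m -> M n -> m < n -> l m < l n.
Proof.
by move=> Mm Mn mn; rewrite (lt_trans (l_lt_nu Mm Mm _) (nu_lt_l _ _ mn)).
Qed.

Let nu_lt m n : M m -> M n -> m < n -> nu m < nu n.
Proof.
by move=> Mm Mn mn; rewrite (lt_trans (nu_lt_l Mm Mn mn) (l_lt_nu _ _ _)).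
Qed.

Let nu_inj m n : M m -> M n -> m != n -> nu m - nu n != 0.
Proof.
move=> Mm Mn; rewrite subr_eq0; case: ltgtP => // mn _.
  by rewrite lt_eqF// nu_lt.
by rewrite gt_eqF// nu_lt.
Qed.

Let l_neq_nu m n : M m -> M n -> l m - nu n != 0.
Proof.
move=> Mm Mn; rewrite subr_eq0; have [mn|mn] := leP m n.
  by rewrite lt_eqF// l_lt_nu.
by rewrite gt_eqF// nu_lt_l.
Qed.

(** [F] records the poles still available: those [nu j] by which [f] may still be divided while
    keeping the sum against [d] equal to 0. *)
Let good (f : int -> R) (F : set int) : Prop :=
  isums (fun n => d n * f n) 0 /\
  forall j, F j -> isums (fun n => d n * f n / (l n - nu j)) 0.

Let good_sub f (F F' : set int) : F' `<=` F -> good f F -> good f F'.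
Proof. by move=> FF' [h1 h2]; split => // j /FF'; exact: h2. Qed.

(** The new factor is [1 + (nu c - l k) / (x - nu c)], and [1 / ((x - nu c) * (x - nu j))] splits
    into simple fractions when [j] differs from [c]. The pole [nu c] is thereby spent and leaves
    [F]; the scalar [t] serves for normalization. *)
Let good_step t f (F : set int) k c : F `<=` B -> F c -> good f F ->
  good (fun n => t * (f n * ((l n - l k) / (l n - nu c)))) (F `\ c).
Proof.
move=> FB Fc [h1 h2]; have Mc := BM (FB _ Fc).
split => [|j [Fj /eqP jc]].
  have := isumsZ t (isumsD h1 (isumsZ (nu c - l k) (h2 _ Fc))).
  rewrite mulr0 addr0 mulr0; apply: eq_isums => n.
  have [Bn|/d0 ->] := pselect (B n); last by rewrite !mul0r mulr0 addr0 mulr0.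
  by field; exact: l_neq_nu (BM Bn) Mc.
have Mj := BM (FB _ Fj).
have := isumsZ t (isumsD (h2 _ Fj)
  (isumsZ ((nu c - l k) / (nu c - nu j)) (isumsB (h2 _ Fc) (h2 _ Fj)))).
rewrite subr0 mulr0 addr0 mulr0; apply: eq_isums => n.
have [Bn|/d0 ->] := pselect (B n).
  field; rewrite !l_neq_nu ?nu_inj//; try exact: BM.
  by rewrite eq_sym.
by rewrite !mul0r subr0 mulr0 addr0 mulr0.
Qed.

(** As a function of [x] this is the Moebius map with value 1 at [x0], value 0 at [a] and pole [b]
    between them. It sends the arc of the projective line from [x0] to [a] through infinity, which
    avoids the pole, monotonically onto [[0, 1]]. *)
Let ratio_r (x x0 a b : R) : x0 < b -> b < a -> x < x0 \/ a < x ->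
  0 <= (x0 - b) / (x0 - a) * ((x - a) / (x - b)) <= 1.
Proof.
move=> x0b ba h.
suff [p [q [-> p0 pq q0]]] : exists p q, [/\
    (x0 - b) / (x0 - a) * ((x - a) / (x - b)) = p / q, 0 <= p, p <= q & 0 < q].
  by rewrite divr_ge0 ?(ltW q0)//= ler_pdivrMr// mul1r.
case: h => h.
  exists ((b - x0) * (a - x)), ((a - x0) * (b - x)); split.
  - by field; nonzero.
  - by apply: mulr_ge0; lra.
  - have : 0 <= (a - b) * (x0 - x) by apply: mulr_ge0; lra.
    by lra.
  - by apply: mulr_gt0; lra.
exists ((b - x0) * (x - a)), ((a - x0) * (x - b)); split.
- by field; nonzero.
- by apply: mulr_ge0; lra.
- by apply: ler_pM; lra.
- by apply: mulr_gt0; lra.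
Qed.

Let ratio_l (x x0 a b : R) : b < x0 -> a < b -> x < a \/ x0 < x ->
  0 <= (x0 - b) / (x0 - a) * ((x - a) / (x - b)) <= 1.
Proof.
move=> x0b ba h.
have -> : (x0 - b) / (x0 - a) * ((x - a) / (x - b)) =
  (- x0 - - b) / (- x0 - - a) * ((- x - - a) / (- x - - b)).
  by field; case: h => h; nonzero.
by apply: ratio_r; [lra|lra|case: h => h; [right|left]; lra].
Qed.

(* The products are built by pairing each pole-cancelling factor [x - l k], for
   [k] to the right of [n0], with the [nu] of the preceding element of [B]. *)
Let test_right n0 (i : nat) : B n0 -> exists f c,
  [/\ B c, n0 <= c <= n0 + i%:Z, forall k, B k -> c < k -> n0 + i%:Z < k &
   [/\ f n0 = 1, forall k, B k -> n0 < k <= n0 + i%:Z -> f k = 0,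
    forall n, B n -> n < n0 \/ n0 + i%:Z < n -> 0 <= f n <= 1 &
    good f [set j | B j /\ (j < n0 \/ c <= j)]]].
Proof.
(* Invariant: [c] is the last index of [B] in the window, and [nu c] is not yet spent. When the
   window reaches a new [k] in [B], the zero [l k] is paired with [nu c], and [nu k] becomes the
   pole kept for the next zero. *)
move=> Bn0; elim: i => [|i [f [c [Bc /andP[n0c ci] nxt [f1 f0 f01 gf]]]]].
  exists (fun=> 1), n0; split => //.
  - by rewrite addr0 lexx.
  - by move=> k _; rewrite addr0.
  - split => //.
    + by move=> k _; rewrite addr0 => /andP[/lt_le_trans h /h]; rewrite ltxx.
    + by move=> n _ _; rewrite ler01 lexx.
    + split; first by move: d_sum; apply: eq_isums => n; rewrite mulr1.
      by move=> j [Bj _]; move: (d_nu Bj); apply: eq_isums => n; rewrite mulr1.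
pose k := n0 + i.+1%:Z.
have ki : forall n : int, (n <= k) = (n <= n0 + i%:Z) || (n == k) by rewrite /k; lia.
have ik : n0 + i%:Z < k by rewrite /k; lia.
have [Bk|nBk] := pselect (B k); last first.
  exists f, c; split => //.
  - by rewrite n0c (le_trans ci)// ltW.
  - move=> n Bn /(nxt _ Bn).
    have : n != k by apply/eqP => nk; apply: nBk; rewrite -nk.
    by rewrite -/k /k; lia.
  - split => //.
    + move=> n Bn /andP[n0n]; rewrite -/k ki => /orP[ni|/eqP nk].
        by apply: f0 => //; rewrite n0n.
      by case: nBk; rewrite -nk.
    + move=> n Bn [h|h]; first by apply: f01 => //; left.
      by apply: f01 => //; right; exact: lt_trans h.
have ck : c < k by exact: le_lt_trans ik.
have n0k : n0 < k by exact: le_lt_trans ck.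
have lnuc : l n0 < nu c by apply: l_lt_nu => //; exact: BM.
have nuclk : nu c < l k by apply: nu_lt_l => //; exact: BM.
exists (fun n => (l n0 - nu c) / (l n0 - l k) *
  (f n * ((l n - l k) / (l n - nu c)))), k; split => //.
- by rewrite ltW//= lexx.
- split.
  + by rewrite f1; field; rewrite !subr_eq0 !lt_eqF// (lt_trans lnuc).
  + move=> n Bn /andP[n0n]; rewrite -/k ki => /orP[ni|/eqP ->].
      by rewrite f0 ?mul0r ?mulr0// n0n.
    by rewrite subrr !(mul0r, mulr0).
  + move=> n Bn h; rewrite mulrCA.
    have /andP[h1 h2] : 0 <= f n <= 1.
      by apply: f01 => //; case: h => h; [left|right => //; exact: lt_trans h].
    have hx : l n < l n0 \/ l k < l n.
      by case: h => h; [left|right]; apply: l_lt => //; exact: BM.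
    have /andP[h3 h4] := ratio_r lnuc nuclk hx.
    by rewrite mulr_ge0//= mulr_ile1.
  + apply: good_sub (good_step _ _ _ _ gf).
    * move=> j /= [Bj h]; split.
        by split => //; case: h => h; [left|right; lia].
      by move=> jc; move: h; rewrite jc; lia.
    * by move=> j [].
    * by split => //; right.
Qed.

(** To the left of [n0] the pole separating [l k] from [l n0] is [nu k] itself, because
    [l k < nu k < l n0]; the right half of the construction has left all poles of index below [n0]
    untouched. *)
Let test_fun n0 (i j : nat) : B n0 -> exists f,
  [/\ f n0 = 1,
    forall k, B k -> k != n0 -> n0 - j%:Z <= k <= n0 + i%:Z -> f k = 0,
    forall n, B n -> n < n0 - j%:Z \/ n0 + i%:Z < n -> 0 <= f n <= 1 &
    good f [set t | B t /\ t < n0 - j%:Z]].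
Proof.
move=> Bn0; elim: j => [|j [f [f1 f0 f01 gf]]].
  have [f [c [_ _ _ [f1 f0 f01 gf]]]] := test_right i Bn0.
  exists f; rewrite subr0; split => //.
  - move=> k Bk kn0 /andP[h1 h2]; apply: f0 => //.
    by rewrite h2 andbT lt_neqAle eq_sym kn0.
  - by apply: good_sub gf => t [Bt tn0]; split => //; left.
pose k := n0 - j.+1%:Z.
have kj : forall n : int, (k <= n) = (n0 - j%:Z <= n) || (n == k) by rewrite /k; lia.
have jk : k < n0 - j%:Z by rewrite /k; lia.
have kn0 : k < n0 by rewrite /k; lia.
have [Bk|nBk] := pselect (B k); last first.
  exists f; split => //.
  - move=> n Bn nn0; rewrite -/k kj => /andP[/orP[h|/eqP nk] h2].
      by apply: f0 => //; rewrite h.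
    by case: nBk; rewrite -nk.
  - by move=> n Bn [h|h]; apply: f01 => //; [left; exact: lt_trans jk|right].
  - by apply: good_sub gf => t [Bt h]; split => //; exact: lt_trans jk.
have lknu : l k < nu k by apply: l_lt_nu => //; exact: BM.
have nukl : nu k < l n0 by apply: nu_lt_l => //; exact: BM.
exists (fun n => (l n0 - nu k) / (l n0 - l k) *
  (f n * ((l n - l k) / (l n - nu k)))); split.
- by rewrite f1; field; rewrite !subr_eq0 !gt_eqF// (lt_trans lknu).
- move=> n Bn nn0; rewrite -/k kj => /andP[/orP[h|/eqP ->] h2].
    by rewrite f0 ?mul0r ?mulr0// h.
  by rewrite subrr !(mul0r, mulr0).
- move=> n Bn h; rewrite mulrCA.
  have /andP[h1 h2] : 0 <= f n <= 1.
    by apply: f01 => //; case: h => h; [left; exact: lt_trans jk|right].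
  have hx : l n < l k \/ l n0 < l n.
    case: h => h; [left|right]; apply: l_lt => //; try exact: BM.
    by lia.
  have /andP[h3 h4] := ratio_l nukl lknu hx.
  by rewrite mulr_ge0//= mulr_ile1.
- apply: good_sub (good_step _ _ _ _ gf).
  + move=> t /= [Bt h]; split; first by split => //; exact: lt_trans jk.
    by move=> tk; move: h; rewrite tk ltxx.
  + by move=> t [].
  + by split.
Qed.

(* The data [d] annihilates [1] and every [1 / (x - nu j)], hence every rational
   function [f] of the shape produced by [test_fun]; on the [l n], [f] is [1] at the
   chosen index, [0] elsewhere in a large window and in [[0, 1]] outside it. *)
Lemma interlacing_uniqueness n : d n = 0.
Proof.
have [Bn|/d0//] := pselect (B n).
apply/eqP; rewrite -normr_le0; apply/ler_addgt0Pr => e e0; rewrite add0r.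
have e20 : 0 < e / 2 by rewrite divr_gt0.
have [N0 hN0] := sums_tail g_sum e20.
(* Beyond [N] the tail of [g] is below [e / 2], and [n] is enumerated before [N]. The window of
   radius [W] contains every integer enumerated before [N], so [d n] is the only nonzero term of the
   initial segment. *)
pose N := maxn N0 (rank n).+1.
have [W hW] : exists W : nat, forall i k, (i < N)%N -> enum i = Some k ->
    n - W%:Z <= k <= n + W%:Z.
  elim: N => [|N' [W hW]]; first by exists 0%N.
  case E : (enum N') => [m|].
    exists (maxn W (absz (m - n)%R)) => i k; rewrite ltnS leq_eqVlt => /predU1P[->|].
      by rewrite E => -[<-]; lia.
    by move=> /hW/[apply]; lia.
  exists W => i k; rewrite ltnS leq_eqVlt => /predU1P[->|]; first by rewrite E.
  exact: hW.
have [f [f1 f0 f01 [gf _]]] := test_fun W W Bn.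
have /cvgrPdist_lt/(_ _ e20)[P0 _ hP0] := gf.
pose P := maxn P0 N.
have := hP0 P (leq_maxl _ _); rewrite sub0r normrN /series /=.
rewrite (@big_cat_nat _ _ _ N) ?leq_maxr//=.
have -> : \sum_(0 <= i < N) oapp (fun n => d n * f n) 0 (enum i) = d n.
  rewrite (bigD1_seq (rank n)) ?iota_uniq//=; last first.
    by rewrite mem_index_iota /= leq_maxr.
  rewrite rankK /= f1 mulr1 big1_seq ?addr0// => i /andP[ipn].
  rewrite mem_index_iota => /andP[_ iN].
  case E : (enum i) => [k|] //=.
  have kn : k != n.
    by apply: contra ipn => /eqP <-; have := enumK i; rewrite E /= => ->.
  have [Bk|/d0 ->] := pselect (B k); last by rewrite mul0r.
  by rewrite f0 ?mulr0//; exact: hW iN E.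
set T := \sum_(N <= i < P) _ => h.
have hT : `|T| < e / 2.
  apply: (@le_lt_trans _ _ (\sum_(N <= i < P) oapp g 0 (enum i))).
    apply: le_trans (ler_norm_sum _ _ _) _; rewrite !big_nat.
    apply: ler_sum => i /andP[Ni iP]; case E : (enum i) => [k|] /=; last first.
      by rewrite normr0.
    have [Bk|/d0 ->] := pselect (B k); last first.
      by rewrite mul0r normr0 (le_trans _ (d_le k)).
    have kn : k != n.
      apply/eqP => kn; have := enumK i; rewrite E /= kn => pi.
      by move: Ni; rewrite -pi /N geq_max ltnn andbF.
    rewrite normrM (le_trans _ (d_le k))// ler_piMr//.
    have [/f0->//|hk] := boolP (n - W%:Z <= k <= n + W%:Z).
      by rewrite normr0.
    have /andP[h1 h2] : 0 <= f k <= 1 by apply: f01 => //; lia.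
    by rewrite ger0_norm.
  have N0N : (N0 <= N)%N by exact: leq_maxl.
  have NP : (N <= P)%N by exact: leq_maxr.
  have g0 i : 0 <= oapp g 0 (enum i).
    by case: enum => [k|] //=; exact: le_trans (d_le k).
  apply: le_lt_trans (hN0 P (leq_trans N0N NP)).
  rewrite (le_trans _ (ler_norm _))// (@big_cat_nat _ _ _ N _ _ _ _ N0N NP) /=.
  by rewrite lerDr sumr_ge0.
have -> : d n = (d n + T) - T by rewrite addrK.
by rewrite (le_trans (ler_normB _ _))// (splitr e) ltW// ltrD.
Qed.

End InterlacingUniqueness.
Arguments isumsZ {R I e} t {f l} _.

(** The case [h1 < h2], where each [nu] precedes its [l]: negating both the indices and the values
    restores the order of the previous theorem. *)
Lemma interlacing_uniqueness_rev {R : realType}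
    (enum : nat -> option int) (rank : int -> nat)
    (M B : set int) (l nu d g : int -> R) (G : R) :
  ocancel enum rank -> pcancel rank enum -> B `<=` M ->
  (forall m n, M m -> M n -> m <= n -> nu m < l n) ->
  (forall m n, M m -> M n -> m < n -> l m < nu n) ->
  (forall n, ~ B n -> d n = 0) -> (forall n, `|d n| <= g n) ->
  sums_along enum g G -> sums_along enum d 0 ->
  (forall j, B j -> sums_along enum (fun n => d n / (l n - nu j)) 0) ->
  forall n, d n = 0.
Proof.
move=> enumK rankK BM h1 h2 d0 dg sg sd sdn n.
pose enum' i := omap -%R (enum i).
have rev f L : sums_along enum f L -> sums_along enum' (fun n => f (- n)) L.
  congr (sums _ _); apply/funext => i; rewrite /enum'.
  by case: (enum i) => [m|] //=; rewrite opprK.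
rewrite -(opprK n).
apply: (@interlacing_uniqueness R enum' (fun n => rank (- n))
  _ _ [set n | M (- n)] [set n | B (- n)] (fun n => - l (- n))
  (fun n => - nu (- n)) (fun n => d (- n)) (fun n => g (- n)) G).
- move=> i; have := enumK i; rewrite /enum'.
  by case: (enum i) => [m|] //=; rewrite opprK.
- by move=> m; rewrite /enum' rankK /= opprK.
- by move=> m; exact: BM.
- by move=> p q Mp Mq pq; rewrite ltrN2 h1// lerN2.
- by move=> p q Mp Mq pq; rewrite ltrN2 h2// ltrN2.
- by move=> m; exact: d0.
- by move=> m; exact: dg.
- exact: rev.
- exact: rev.
- move=> j /sdn/(isumsZ (-1))/rev; rewrite mulr0; apply: eq_isums => m.
  by rewrite -opprD invrN mulrN mulN1r.
Qed.


(** * Weyl's alternative for Jacobi matrices *)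

Section RealJacobi.
Context {R : realType}.
Variables a b : nat -> R.
Implicit Types f k x y z : nat -> R.

Definition rtau x : nat -> R := fun n =>
  match n with
  | 0%N => a 0%N * x 0%N + b 0%N * x 1%N
  | m.+1 => b m * x m + a m.+1 * x m.+1 + b m.+1 * x m.+2
  end.

Lemma rtau_lin t x y : rtau (x + t *: y) = rtau x + t *: rtau y.
Proof. by apply/funext => -[|n]; rewrite !fctE /GRing.scale /=; ring. Qed.

Lemma rtauZ t x : rtau (t *: x) = t *: rtau x.
Proof. by apply/funext => -[|n]; rewrite !fctE /GRing.scale /=; ring. Qed.

Lemma rtauB x y : rtau (x - y) = rtau x - rtau y.
Proof. by rewrite -scaleN1r rtau_lin scaleN1r. Qed.

Definition finsupp x : Prop := exists N, forall n, (N <= n)%N -> x n = 0.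

Lemma finsupp_lin t x y : finsupp x -> finsupp y -> finsupp (x + t *: y).
Proof.
move=> [N xN] [P yP]; exists (maxn N P) => n; rewrite geq_max => /andP[Nn Pn].
by rewrite !fctE xN// yP// scaler0 addr0.
Qed.

Lemma finsupp_basis n : finsupp (basis n).
Proof. by exists n.+1 => m; exact: basis_fin. Qed.

Lemma finsupp_rtau x : finsupp x -> finsupp (rtau x).
Proof.
move=> [N xN]; exists N.+1 => -[//|n] nN /=.
by rewrite !xN ?mulr0 ?addr0//; lia.
Qed.

Lemma finsupp_l2r x : finsupp x -> l2r x.
Proof. by move=> [N]; exact: l2r_fin. Qed.

Definition dmax x : Prop := l2r x /\ l2r (rtau x).

Lemma dmax_lin t x y : dmax x -> dmax y -> dmax (x + t *: y).
Proof.
move=> [lx ltx] [ly lty]; split; first by apply: l2rD => //; exact: l2rZ.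
by rewrite rtau_lin; apply: l2rD => //; exact: l2rZ.
Qed.

Lemma dmaxB x y : dmax x -> dmax y -> dmax (x - y).
Proof. by rewrite -scaleN1r; exact: dmax_lin. Qed.

Lemma finsupp_dmax x : finsupp x -> dmax x.
Proof. by move=> fx; split; apply: finsupp_l2r => //; exact: finsupp_rtau. Qed.

Definition wr f k n : R := b n * (f n * k n.+1 - k n * f n.+1).

Lemma wrS f k n :
  wr f k n.+1 = wr f k n + (f n.+1 * rtau k n.+1 - k n.+1 * rtau f n.+1).
Proof. by rewrite /wr /=; ring. Qed.

Lemma wr_green f k n :
  \sum_(0 <= i < n.+1) (f i * rtau k i - k i * rtau f i) = wr f k n.
Proof.
elim: n => [|n IH]; first by rewrite big_nat1 /wr /=; ring.
by rewrite big_nat_recr//= IH wrS.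
Qed.

(** Green's identity against a finitely supported sequence: both sums are finite and the boundary
    term vanishes beyond the support, so [z] may be arbitrary. *)
Lemma dot_rtau_basis z n : dot z (rtau (basis n)) = rtau z n.
Proof.
have e0 i : (n < i)%N -> basis n i = 0 :> R by exact: basis_fin.
have h : sums (fun i => z i * rtau (basis n) i)
    (\sum_(0 <= i < n.+2) z i * rtau (basis n) i).
  apply: sums_fin => -[//|i] ni; rewrite /= !e0 ?(mulr0, addr0)//; lia.
have h' : sums (fun i => basis n i * rtau z i)
    (\sum_(0 <= i < n.+2) basis n i * rtau z i).
  by apply: sums_fin => i ni; rewrite e0 ?mul0r// ltnW.
rewrite (dot_sums h) -(dot_basis n (rtau z)) (dot_sums h').
apply/eqP; rewrite -subr_eq0 -sumrB wr_green /wr !e0//.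
by rewrite mulr0 mul0r subrr mulr0.
Qed.

Lemma wr_cvg f k : dmax f -> dmax k ->
  wr f k @ \oo --> dot f (rtau k) - dot (rtau f) k.
Proof.
move=> [lf ltf] [lk ltk]; rewrite (dotC _ k).
have := sumsB (dotP lf ltk) (dotP lk ltf); rewrite /sums.
rewrite -(cvg_shiftS (series _)); apply: cvg_trans.
by apply: near_eq_cvg; apply: nearW => n; rewrite /series /= wr_green.
Qed.

Lemma plucker f k u n : u n * wr f k n = f n * wr u k n - k n * wr u f n.
Proof. by rewrite /wr; ring. Qed.

(** Since [rtau f] vanishes off the first index, Green's identity makes the increment of [wr f k]
    from 0 to [n] equal to the sum of [f i * rtau k i] over [0 < i <= n]. Cauchy-Schwarz is applied
    to [F], the truncation of [f] to these indices. *)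
Lemma wr_bound f k n : (forall m, (0 < m)%N -> rtau f m = 0) -> l2r (rtau k) ->
  wr f k n ^+ 2 <= 2 * wr f k 0 ^+ 2 +
    2 * (\sum_(0 <= i < n.+1) f i ^+ 2) * nrm2 (rtau k).
Proof.
move=> tf0 ltk; pose F := fun i => if (0 < i <= n)%N then f i else 0.
have lF : l2r F.
  by apply: (@l2r_fin _ _ n.+1) => i ni; rewrite /F [(i <= n)%N]leqNgt ni andbF.
have -> : wr f k n = wr f k 0 + dot F (rtau k).
  have h : sums (fun i => F i * rtau k i) (\sum_(0 <= i < n.+1) F i * rtau k i).
    by apply: sums_fin => i ni; rewrite /F [(i <= n)%N]leqNgt ni andbF mul0r.
  rewrite (dot_sums h) -!wr_green big_nat1 !(@big_nat_recl _ _ _ n)//.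
  rewrite (_ : F 0%N = 0)// mul0r add0r; congr (_ + _).
  rewrite !big_nat; apply: eq_bigr => i /andP[_ ni].
  by rewrite tf0// mulr0 subr0 /F ltn0Sn ni.
have h1 : nrm2 F <= \sum_(0 <= i < n.+1) f i ^+ 2.
  apply: nrm2_bound => N; have hF i : F i ^+ 2 <= f i ^+ 2.
    by rewrite /F; case: ifP => // _; rewrite expr0n sqr_ge0.
  apply: (@le_trans _ _ (\sum_(0 <= i < maxn N n.+1) F i ^+ 2)).
    rewrite [leRHS](@big_cat_nat _ _ _ N) ?leq_maxl//= lerDl sumr_ge0// => i _.
    exact: sqr_ge0.
  rewrite (@big_cat_nat _ _ _ n.+1) ?leq_maxr//= [X in _ + X]big_nat_cond.
  rewrite [X in _ + X]big1 ?addr0.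
    by apply: ler_sum => i _; exact: hF.
  by move=> i /andP[/andP[ni _] _]; rewrite /F [(i <= n)%N]leqNgt ni andbF expr0n.
have h2 := cauchy_schwarz lF ltk.
have h3 := ler_wpM2r (nrm2_ge0 ltk) h1.
have := sqr_ge0 (wr f k 0 - dot F (rtau k)); lra.
Qed.

(* If [W(f, k)] has a nonzero limit, the identity [u W(f,k) = f W(u,k) - k W(u,f)]
   bounds [u n ^+ 2] by [(f n ^+ 2 + k n ^+ 2) (1 + \sum_(i <= n) u i ^+ 2)] up to
   a constant; square summability of [f] and [k] then closes a Gronwall loop. *)
Lemma weyl_l2 f k u : dmax f -> dmax k ->
  dot f (rtau k) <> dot (rtau f) k ->
  (forall n, (0 < n)%N -> rtau u n = 0) -> l2r u.
Proof.
move=> df dk /eqP; rewrite -subr_eq0 => w0 tu0.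
set w := _ - _ in w0; have w2 : 0 < w ^+ 2 by rewrite exprn_even_gt0.
have := wr_cvg df dk; rewrite -/w => hw.
have [N1 hN1] : exists N1, forall n, (N1 <= n)%N -> w ^+ 2 / 4 <= wr f k n ^+ 2.
  have : 0 < `|w| / 2 by rewrite divr_gt0// normr_gt0.
  move: hw => /cvgrPdist_lt h /h[N1 _ hN1]; exists N1 => n /hN1 /= hn.
  rewrite -(real_normK (num_real w)) -(real_normK (num_real (wr f k n))).
  have : `|w| / 2 <= `|wr f k n|.
    have := ler_normD (w - wr f k n) (wr f k n); rewrite subrK; lra.
  move=> h1; have : (`|w| / 2) ^+ 2 <= `|wr f k n| ^+ 2.
    by rewrite lerXn2r ?nnegrE// divr_ge0.
  by rewrite expr_div_n => h2; apply: le_trans h2; rewrite -natrX.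
have [[lf ltf] [lk ltk]] := (df, dk).
pose U n := \sum_(0 <= i < n) u i ^+ 2.
have U0 n : 0 <= U n by apply: sumr_ge0 => i _; exact: sqr_ge0.
(* The factor 8 is 4, from [wr f k n ^+ 2 >= w ^+ 2 / 4], times 2, from squaring the two-term
   identity; the bracket dominates both instances of [wr_bound]. *)
pose D := 8 / w ^+ 2 * (2 * wr u k 0 ^+ 2 + 2 * wr u f 0 ^+ 2 +
   2 * nrm2 (rtau k) + 2 * nrm2 (rtau f)).
pose phi n := D * (f n ^+ 2 + k n ^+ 2).
have nk0 := nrm2_ge0 ltk; have nf0 := nrm2_ge0 ltf.
have D0 : 0 <= D.
  rewrite mulr_ge0// ?divr_ge0 ?(ltW w2)// !addr_ge0// mulr_ge0// sqr_ge0//.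
have phi0 n : 0 <= phi n by rewrite mulr_ge0// addr_ge0// sqr_ge0.
have uphi n : (N1 <= n)%N -> u n ^+ 2 <= phi n * (1 + U n.+1).
  move=> /hN1 h.
  have e : (u n * wr f k n) ^+ 2 <=
      2 * (f n ^+ 2 * wr u k n ^+ 2) + 2 * (k n ^+ 2 * wr u f n ^+ 2).
    rewrite plucker -!exprMn; have := sqr_ge0 (f n * wr u k n + k n * wr u f n).
    by lra.
  pose Q := 2 * wr u k 0 ^+ 2 + 2 * wr u f 0 ^+ 2 +
    2 * nrm2 (rtau k) + 2 * nrm2 (rtau f).
  have hQ1 : wr u k n ^+ 2 <= Q * (1 + U n.+1).
    apply: le_trans (wr_bound n tu0 ltk) _; rewrite -/(U n.+1) /Q.
    have := mulr_ge0 (sqr_ge0 (wr u k 0)) (U0 n.+1).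
    have := mulr_ge0 (sqr_ge0 (wr u f 0)) (U0 n.+1).
    have := mulr_ge0 nf0 (U0 n.+1); have := sqr_ge0 (wr u f 0); lra.
  have hQ2 : wr u f n ^+ 2 <= Q * (1 + U n.+1).
    apply: le_trans (wr_bound n tu0 ltf) _; rewrite -/(U n.+1) /Q.
    have := mulr_ge0 (sqr_ge0 (wr u k 0)) (U0 n.+1).
    have := mulr_ge0 (sqr_ge0 (wr u f 0)) (U0 n.+1).
    have := mulr_ge0 nk0 (U0 n.+1); have := sqr_ge0 (wr u k 0); lra.
  have h1 := ler_wpM2l (sqr_ge0 (f n)) hQ1.
  have h2 := ler_wpM2l (sqr_ge0 (k n)) hQ2.
  have h3 := ler_wpM2l (sqr_ge0 (u n)) h.
  have h4 : w ^+ 2 * u n ^+ 2 <= w ^+ 2 * (phi n * (1 + U n.+1)).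
    have -> : w ^+ 2 * (phi n * (1 + U n.+1)) =
        8 * (f n ^+ 2 + k n ^+ 2) * (Q * (1 + U n.+1)).
      by rewrite /phi /D -/Q; field.
    by rewrite exprMn in e; lra.
  by rewrite ler_pM2l in h4.
have [l hl] : exists l, sums phi l.
  by eexists; exact: sumsZ (sumsD (nrm2P lf) (nrm2P lk)).
have [|N2 hN2] := sums_tail hl (_ : 0 < 2^-1); first by rewrite invr_gt0.
(* Beyond [N2] the sum of [phi] is below 1/2, so [U P <= U N + (1 + U P) / 2], and the unknown [U P]
   can be absorbed on the left. *)
pose N := maxn N1 N2.
have Utail P : (N <= P)%N -> U P <= 2 * U N + 1.
  move=> NP; have : U P <= U N + 2^-1 * (1 + U P).
    rewrite {1}/U (@big_cat_nat _ _ _ N)//= lerD2l.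
    apply: (@le_trans _ _ (\sum_(N <= i < P) phi i * (1 + U P))).
      rewrite !big_nat; apply: ler_sum => i /andP[Ni iP].
      apply: le_trans (uphi _ _) _; first by rewrite (leq_trans _ Ni)// leq_maxl.
      rewrite ler_wpM2l// lerD2l /U [leRHS](@big_cat_nat _ _ _ i.+1)//= lerDl.
      by apply: sumr_ge0 => j _; exact: sqr_ge0.
    rewrite -mulr_suml ler_wpM2r ?addr_ge0// ltW//.
    have N2N : (N2 <= N)%N by exact: leq_maxr.
    apply: le_lt_trans (hN2 P (leq_trans N2N NP)).
    rewrite (le_trans _ (ler_norm _))// (@big_cat_nat _ _ _ N _ _ _ _ N2N NP) /=.
    by rewrite lerDr sumr_ge0.
  lra.
apply: (@bounded_l2r _ _ (2 * U N + 1)) => P; rewrite -/(U P).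
have [NP|PN] := leqP N P; first exact: Utail.
have : U P <= U N.
  rewrite /U [leRHS](@big_cat_nat _ _ _ P) ?(ltnW PN)//= lerDl.
  by apply: sumr_ge0 => j _; exact: sqr_ge0.
have := U0 N; lra.
Qed.

End RealJacobi.

(** * The closure of the minimal operator, on real sequences *)

Section Closure.
Context {R : realType}.
Variables a b : nat -> R.
Implicit Types f x y z p q : nat -> R.

Lemma harmonic_cauchy_cvg (u : nat -> R) :
  (forall k l, (u k - u l) ^+ 2 <= 2 * harmonic k + 2 * harmonic l) -> cvgn u.
Proof.
move=> hu; apply/cauchy_cvgP/cauchy_exP => e e0.
have e2 : 0 < e ^+ 2 / 4 by rewrite divr_gt0// exprn_gt0.
have /cvgrPdist_lt/(_ _ e2)[N _ hN] := @cvg_harmonic R.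
have {}hN k : (N <= k)%N -> harmonic k < e ^+ 2 / 4.
  by move=> /hN; rewrite sub0r normrN ger0_norm// ltW// harmonic_gt0.
exists (u N); exists N => // k /= Nk; rewrite /ball /= -(@ltr_pXn2r _ 2)//.
- rewrite real_normK ?num_real//; apply: le_lt_trans (hu _ _) _.
  by have := hN _ Nk; have := hN _ (leqnn N); lra.
- by rewrite nnegrE ltW.
Qed.

Lemma fatou_sqr (u : nat -> nat -> R) (v : nat -> R) (c : nat -> R) C N :
  (forall i, u ^~ i @ \oo --> v i) -> c @ \oo --> C ->
  (forall l, \sum_(0 <= i < N) u l i ^+ 2 <= c l) ->
  \sum_(0 <= i < N) v i ^+ 2 <= C.
Proof.
move=> uv cC h; apply: (@ler_cvg_to _ \oo _ _
    (fun l => \sum_(0 <= i < N) u l i ^+ 2) c) => //.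
- elim: N {h} => [|N IH].
    by rewrite big_geq//; under eq_fun do rewrite big_geq//; exact: cvg_cst.
  rewrite big_nat_recr//=; under eq_fun do rewrite big_nat_recr//=.
  by apply: cvgD => //; rewrite expr2; under eq_fun do rewrite expr2; exact: cvgM.
- exact: nearW.
Qed.

Definition clos x y : Prop := [/\ l2r x, l2r y & forall e, 0 < e ->
  exists f, [/\ finsupp f, nrm2 (x - f) < e & nrm2 (y - rtau a b f) < e]].

(** Although [rtau] may be unbounded, each coordinate of it involves at most three entries. Graph
    limits therefore commute with [rtau] coordinatewise, which is how the closure is seen to act as
    [rtau]. *)
Lemma rtau_coord_le n : exists2 K, 0 <= K &
  forall z, l2r z -> rtau a b z n ^+ 2 <= K * nrm2 z.
Proof.
pose K := 3 * (b n.-1 ^+ 2 + a n ^+ 2 + b n ^+ 2).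
have K0 : 0 <= K by rewrite mulr_ge0// !addr_ge0// sqr_ge0.
have sq3 (u v w : R) : (u + v + w) ^+ 2 <= 3 * (u ^+ 2 + v ^+ 2 + w ^+ 2).
  by have := sqr_ge0 (u - v); have := sqr_ge0 (u - w); have := sqr_ge0 (v - w); lra.
exists K => // z lz; have hz m := ler_wpM2l (sqr_ge0 _) (coord_le m lz).
case: n @K K0 => [|n] K K0 /=.
  rewrite -[X in X ^+ 2]addr0; apply: le_trans (sq3 _ _ _) _.
  rewrite !exprMn /K expr0n addr0 /=.
  have := hz (a 0%N) 0%N; have := hz (b 0%N) 1%N.
  by have := mulr_ge0 (sqr_ge0 (b 0%N)) (nrm2_ge0 lz); lra.
apply: le_trans (sq3 _ _ _) _; rewrite !exprMn /K /=.
by have := hz (b n) n; have := hz (a n.+1) n.+1; have := hz (b n.+1) n.+2; lra.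
Qed.

Lemma clos_rtau x y : clos x y -> y = rtau a b x.
Proof.
move=> [lx ly h]; apply/funext => n; apply/eqP; rewrite -subr_eq0 -sqrf_eq0.
rewrite eq_le sqr_ge0 andbT; have [K K0 hK] := rtau_coord_le n.
apply/ler_addgt0Pr => e e0; rewrite add0r.
have K1 : 0 < 2 * (1 + K) by rewrite mulr_gt0// ltr_wpDr.
have [|f [ff h1 h2]] := h (e / (2 * (1 + K))); first by rewrite divr_gt0.
have lxf : l2r (x - f) by apply: l2rB => //; exact: finsupp_l2r.
have lyf : l2r (y - rtau a b f).
  by apply: l2rB => //; exact/finsupp_l2r/finsupp_rtau.
have := hK _ lxf; rewrite rtauB => hxf.
have := coord_le n lyf => hyf.
have e1 : e = e / (2 * (1 + K)) * 2 + e / (2 * (1 + K)) * (2 * K).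
  by field; rewrite gt_eqF// ltr_wpDr.
have h3 := ler_wpM2l K0 (ltW h1).
rewrite {}e1; set d := e / _ in h1 h2 h3 *.
have := sqr_ge0 ((y - rtau a b f) n + (rtau a b x - rtau a b f) n).
have -> : y n - rtau a b x n =
  (y - rtau a b f) n - (rtau a b x - rtau a b f) n by rewrite !fctE; ring.
by move=> ?; lra.
Qed.

Lemma finsupp_clos f : finsupp f -> clos f (rtau a b f).
Proof.
move=> ff; split; [exact: finsupp_l2r|exact/finsupp_l2r/finsupp_rtau|].
by move=> e e0; exists f; rewrite !subrr nrm20.
Qed.

Lemma clos_lin t x y x' y' : clos x y -> clos x' y' ->
  clos (x + t *: x') (y + t *: y').
Proof.
move=> [lx ly h] [lx' ly' h']; split; try by apply: l2rD => //; exact: l2rZ.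
move=> e e0; have t0 : 0 < 4 * (1 + t ^+ 2).
  by rewrite mulr_gt0// ltr_wpDr// sqr_ge0.
pose d := e / (4 * (1 + t ^+ 2)).
have d0 : 0 < d by rewrite divr_gt0.
have [[f [ff h1 h2]] [f' [ff' h1' h2']]] := (h _ d0, h' _ d0).
exists (f + t *: f'); split; first exact: finsupp_lin.
  have -> : x + t *: x' - (f + t *: f') = (x - f) + t *: (x' - f').
    by rewrite scalerBr opprD addrACA.
  have lxf : l2r (x - f) by apply: l2rB => //; exact: finsupp_l2r.
  have lxf' : l2r (x' - f') by apply: l2rB => //; exact: finsupp_l2r.
  apply: le_lt_trans (nrm2D_le lxf (l2rZ t lxf')) _; rewrite nrm2Z//.
  have := ler_wpM2l (sqr_ge0 t) (ltW h1').
  have : e = d * (4 * (1 + t ^+ 2)) by rewrite /d divfK// gt_eqF.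
  have := mulr_ge0 (ltW d0) (sqr_ge0 t); lra.
rewrite rtau_lin.
have -> : y + t *: y' - (rtau a b f + t *: rtau a b f') =
  (y - rtau a b f) + t *: (y' - rtau a b f') by rewrite scalerBr opprD addrACA.
have lyf : l2r (y - rtau a b f).
  by apply: l2rB => //; exact/finsupp_l2r/finsupp_rtau.
have lyf' : l2r (y' - rtau a b f').
  by apply: l2rB => //; exact/finsupp_l2r/finsupp_rtau.
apply: le_lt_trans (nrm2D_le lyf (l2rZ t lyf')) _; rewrite nrm2Z//.
have := ler_wpM2l (sqr_ge0 t) (ltW h2').
have : e = d * (4 * (1 + t ^+ 2)) by rewrite /d divfK// gt_eqF.
have := mulr_ge0 (ltW d0) (sqr_ge0 t); lra.
Qed.

(* The graph distance from [x] to the finitely supported sequences is attained at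
   some [p] with [p + rtau (rtau p) = 0], so [|rtau p|^2 = - |p|^2] by symmetry. *)
Lemma dmax_clos x :
  (forall f k, dmax a b f -> dmax a b k ->
    dot f (rtau a b k) = dot (rtau a b f) k) ->
  dmax a b x -> clos x (rtau a b x).
Proof.
set tau := rtau a b => sym dx; have [lx ltx] := dx; split => // e e0.
pose E p := nrm2 p + nrm2 (tau p).
pose S := [set t | exists2 p, finsupp (x - p) & t = E p].
have S_dmax p : finsupp (x - p) -> dmax a b p.
  by move=> /(finsupp_dmax a b) h; rewrite -[p](subKr x); exact: dmaxB.
have E0 p : dmax a b p -> 0 <= E p.
  by move=> [lp ltp]; rewrite addr_ge0// nrm2_ge0.
have lbS : lbound S 0 by move=> _ [p /S_dmax dp ->]; exact: E0.
have hS : has_inf S.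
  split; last by exists 0.
  by exists (E x), x => //; rewrite subrr; exists 0%N.
have infS p : finsupp (x - p) -> inf S <= E p.
  by move=> fp; apply: inf_lbound; [exists 0|exists p].
have /choice[p hp] k : exists p, finsupp (x - p) /\ E p < inf S + harmonic k.
  have [_ [p fp ->] h] := inf_adherent (harmonic_gt0 k : 0 < harmonic k :> R) hS.
  by exists p.
have fp k : finsupp (x - p k) by case: (hp k).
have {hp} Ep k : E (p k) < inf S + harmonic k by case: (hp k).
have dp k := S_dmax _ (fp k).
have ED t u v : dmax a b u -> dmax a b v ->
    E (u + t *: v) = E u + 2 * t * (dot u v + dot (tau u) (tau v)) + t ^+ 2 * E v.
  move=> [lu ltu] [lv ltv]; rewrite /E /tau rtau_lin -/tau.
  rewrite !nrm2D ?nrm2Z ?dotZr//; try exact: l2rZ.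
  by ring.
have EZ t u : dmax a b u -> E (t *: u) = t ^+ 2 * E u.
  by move=> [lu ltu]; rewrite /E /tau rtauZ !nrm2Z// mulrDr.
(* Parallelogram law: the midpoint of [p k] and [p l] is again a competitor, so its energy is at
   least [inf S]. The minimizing sequence is thus Cauchy in graph norm. *)
have Epp k l : E (p k - p l) <= 2 * harmonic k + 2 * harmonic l.
  have : inf S <= E (2^-1 *: (p k + 1 *: p l)).
    apply: infS; rewrite (_ : _ - _ =
        (x - p k) + 2^-1 *: ((x - p l) + (-1) *: (x - p k))).
      by apply: finsupp_lin => //; exact: finsupp_lin.
    by apply/funext => i; rewrite !fctE /GRing.scale /=; field.
  rewrite EZ; last exact: dmax_lin.
  rewrite -(scaleN1r (p l)) !ED//.
  have := Ep k; have := Ep l; lra.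
have coordE u i : dmax a b u -> u i ^+ 2 <= E u.
  by move=> [lu ltu]; apply: le_trans (coord_le i lu) _; rewrite lerDl nrm2_ge0.
pose P i := limn (p ^~ i).
have pP i : p ^~ i @ \oo --> P i.
  apply: harmonic_cauchy_cvg => k l; apply: le_trans (Epp k l).
  exact: (coordE (p k - p l) i (dmaxB (dp k) (dp l))).
have tpP i : (fun k => tau (p k) i) @ \oo --> tau P i.
  by case: i => [|i] /=; repeat apply: cvgD; apply: cvgMl_tmp; exact: pP.
have ch k : (fun l => 2 * harmonic k + 2 * harmonic l : R) @ \oo -->
    (2 * harmonic k : R).
  rewrite -[X in _ --> X]addr0 -[X in _ --> _ + X](mulr0 (2 : R)).
  by apply: cvgD; [exact: cvg_cst|exact: cvgMl_tmp (@cvg_harmonic R)].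
(* Finite partial sums pass to the coordinatewise limit in [l]; this shows that [p k - P] is square
   summable and small at once. *)
have hpP k N : \sum_(0 <= i < N) (p k - P) i ^+ 2 <= 2 * harmonic k.
  apply: (@fatou_sqr (fun l => p k - p l)) (ch k) _ => [i|l].
    by apply: cvgB; [exact: cvg_cst|exact: pP].
  have [lpp ltpp] := dmaxB (dp k) (dp l).
  apply: le_trans (nrm2_le N lpp) (le_trans _ (Epp k l)).
  by rewrite lerDl nrm2_ge0.
have htpP k N : \sum_(0 <= i < N) tau (p k - P) i ^+ 2 <= 2 * harmonic k.
  apply: (@fatou_sqr (fun l => tau (p k - p l))) (ch k) _ => [i|l].
    rewrite /tau rtauB; under eq_fun do rewrite rtauB.
    by apply: cvgB; [exact: cvg_cst|exact: tpP].
  have [lpp ltpp] := dmaxB (dp k) (dp l).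
  apply: le_trans (nrm2_le N ltpp) (le_trans _ (Epp k l)).
  by rewrite lerDr nrm2_ge0.
have dpP k : dmax a b (p k - P) by split; exact: bounded_l2r.
have dP : dmax a b P by rewrite -(subKr (p 0%N) P); exact: dmaxB.
have ortho n : P n + tau (tau P) n = 0.
  have db := finsupp_dmax a b (finsupp_basis n).
  pose c := E (basis n).
  have c_gt0 : 0 < c.
    apply: lt_le_trans (coordE _ n db); by rewrite /basis eqxx expr1n.
  pose be k := p k n + tau (tau (p k)) n.
  have hbe : be @ \oo --> P n + tau (tau P) n.
    apply: cvgD; first exact: pP.
    by case: (n) => [|i]; repeat apply: cvgD; apply: cvgMl_tmp; exact: tpP.
  set t := P n + _ in hbe *.
  (* First variation in the direction [basis n]. The step [- t / c] minimizes the limiting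
     quadratic, whose minimum [- t ^+ 2 / c] must be nonnegative, so [t = 0]. *)
  have h k : - harmonic k <= 2 * (- t / c) * be k + (- t / c) ^+ 2 * c.
    have : inf S <= E (p k + (- t / c) *: basis n).
      apply: infS; rewrite (_ : _ - _ = (x - p k) + (t / c) *: basis n).
        by apply: finsupp_lin => //; exact: finsupp_basis.
      by rewrite opprD addrA -scaleNr mulNr opprK.
    rewrite ED// /tau dot_rtau_basis dotC dot_basis -/tau -/(be k) -/c.
    by have := Ep k; lra.
  have : - 0 <= 2 * (- t / c) * t + (- t / c) ^+ 2 * c.
    apply: (@ler_cvg_to _ \oo _ _ (fun k => - harmonic k)
      (fun k => 2 * (- t / c) * be k + (- t / c) ^+ 2 * c)).
    - by apply: cvgN; exact: cvg_harmonic.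
    - by apply: cvgD; [exact: cvgMl_tmp|exact: cvg_cst].
    - exact: nearW.
  have -> : 2 * (- t / c) * t + (- t / c) ^+ 2 * c = - (t ^+ 2 / c).
    by field; rewrite gt_eqF.
  rewrite lerN2 pmulr_lle0 ?invr_gt0// => t2.
  by apply/eqP; rewrite -sqrf_eq0 eq_le t2 sqr_ge0.
have [lP ltP] := dP.
have ttP : tau (tau P) = - P.
  by apply/funext => n; apply/eqP; rewrite -subr_eq0 fctE opprK addrC ortho.
have dtP : dmax a b (tau P).
  by split => //; rewrite -/tau ttP -scaleN1r; exact: l2rZ.
have P0 : P = 0.
  apply: nrm2_eq0 => //; have := sym _ _ dP dtP.
  rewrite -/tau ttP -scaleN1r dotZr// -/(nrm2 _) -/(nrm2 _).
  by have := nrm2_ge0 ltP; lra.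
have [k hk] : exists k, 2 * harmonic k < e.
  have e20 : 0 < e / 2 by rewrite divr_gt0.
  have /cvgrPdist_lt/(_ _ e20)[N _ /(_ N (leqnn N))] := @cvg_harmonic R.
  rewrite /= sub0r normrN ger0_norm ?(ltW (harmonic_gt0 _))// => h.
  by exists N; rewrite mulrC -ltr_pdivlMr.
(* Since [P = 0], the error [p k] equals [p k - P], which is small in graph norm. *)
exists (x - p k); split => //.
  apply: le_lt_trans hk; rewrite subKr; apply: nrm2_bound => N.
  by have := hpP k N; rewrite P0 subr0.
apply: le_lt_trans hk; rewrite -rtauB subKr; apply: nrm2_bound => N.
by have := htpP k N; rewrite P0 subr0.
Qed.

End Closure.
(** * Reduction to real sequences *)

Section ComplexToReal.
Local Open Scope complex_scope.
Context {R : realType}.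
Implicit Types f k : nat -> R[i].

Definition re f : nat -> R := fun n => complex.Re (f n).
Definition im f : nat -> R := fun n => complex.Im (f n).
Definition cseq (x y : nat -> R) : nat -> R[i] := fun n => x n +i* y n.

Lemma re_cseq x y : re (cseq x y) = x. Proof. by []. Qed.
Lemma im_cseq x y : im (cseq x y) = y. Proof. by []. Qed.
Lemma cseqK f : cseq (re f) (im f) = f.
Proof. by apply/funext => n; rewrite /cseq /re /im; case: (f n). Qed.

Lemma cseq_inj f k : re f = re k -> im f = im k -> f = k.
Proof. by move=> h1 h2; rewrite -(cseqK f) -(cseqK k) h1 h2. Qed.

Lemma ReM_real (r : R) z : complex.Re (r%:C * z) = r * complex.Re z.
Proof. by case: z => x y /=; rewrite mul0r subr0. Qed.

Lemma ImM_real (r : R) z : complex.Im (r%:C * z) = r * complex.Im z.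
Proof. by case: z => x y /=; rewrite mul0r addr0. Qed.

Lemma ReD (z w : R[i]) : complex.Re (z + w) = complex.Re z + complex.Re w.
Proof. by case: z w => [? ?] [? ?]. Qed.

Lemma ImD (z w : R[i]) : complex.Im (z + w) = complex.Im z + complex.Im w.
Proof. by case: z w => [? ?] [? ?]. Qed.

Lemma ReN (z : R[i]) : complex.Re (- z) = - complex.Re z.
Proof. by case: z. Qed.

Lemma ImN (z : R[i]) : complex.Im (- z) = - complex.Im z.
Proof. by case: z. Qed.

Lemma re_sub f k : re (fun n => f n - k n) = re f - re k.
Proof. by apply/funext => n; rewrite /re ReD ReN. Qed.

Lemma im_sub f k : im (fun n => f n - k n) = im f - im k.
Proof. by apply/funext => n; rewrite /im ImD ImN. Qed.

Lemma cabs_sqr (z : R[i]) : cabs z ^+ 2 = complex.Re z ^+ 2 + complex.Im z ^+ 2.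
Proof. by rewrite /cabs sqr_sqrtr// addr_ge0// sqr_ge0. Qed.

Lemma esums (F : nat -> R) l : sums F l ->
  (\sum_(0 <= n <oo) (F n)%:E)%E = l%:E.
Proof.
move=> Fl; rewrite -(cvg_lim (@Rhausdorff R) Fl) -EFin_lim; last first.
  by apply/cvg_ex; exists l.
by congr (limn _); apply/funext => N /=; rewrite sumEFin.
Qed.

Lemma sqnormE f : l2r (re f) -> l2r (im f) ->
  sqnorm f = (nrm2 (re f) + nrm2 (im f))%:E.
Proof.
move=> lf1 lf2; rewrite -(esums (sumsD (nrm2P lf1) (nrm2P lf2))).
by apply: eq_eseriesr => n _; rewrite cabs_sqr.
Qed.

Lemma l2P f : l2 f <-> l2r (re f) /\ l2r (im f).
Proof.
split=> [lf|[lf1 lf2]]; last by rewrite /l2 sqnormE// ltry.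
have h N : \sum_(0 <= i < N) (cabs (f i) ^+ 2) <= fine (sqnorm f).
  have f0 n : (0 <= n)%N -> true -> (0 <= (cabs (f n) ^+ 2)%:E :> \bar R)%E.
    by move=> _ _; rewrite lee_fin sqr_ge0.
  have := nneseries_lim_ge N f0; rewrite -/(sqnorm f) sumEFin => h.
  rewrite -lee_fin fineK// ge0_fin_numE//.
  by apply: le_trans h; rewrite lee_fin sumr_ge0// => i _; exact: sqr_ge0.
by split; apply: (@bounded_l2r _ _ (fine (sqnorm f))) => N;
  apply: le_trans (h N); apply: ler_sum => i _; rewrite cabs_sqr;
  rewrite ?lerDl ?lerDr sqr_ge0.
Qed.

Lemma cseq_l2 x y : l2r x -> l2r y -> l2 (cseq x y).
Proof. by move=> lx ly; apply/l2P. Qed.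

Lemma innerE f k : l2 f -> l2 k ->
  inner f k = (dot (re f) (re k) + dot (im f) (im k)) +i*
              (dot (im f) (re k) - dot (re f) (im k)).
Proof.
move=> /l2P[lf1 lf2] /l2P[lk1 lk2]; rewrite /inner; congr (_ +i* _).
  rewrite -(cvg_lim (@Rhausdorff R) (sumsD (dotP lf1 lk1) (dotP lf2 lk2))).
  congr (limn (series _)); apply/funext => n; rewrite /re /im.
  by case: (f n) (k n) => [? ?] [? ?] /=; ring.
rewrite -(cvg_lim (@Rhausdorff R) (sumsB (dotP lf2 lk1) (dotP lf1 lk2))).
congr (limn (series _)); apply/funext => n; rewrite /re /im.
by case: (f n) (k n) => [? ?] [? ?] /=; ring.
Qed.

Lemma sqnorm_lt f (e : R) : l2 f -> (sqnorm f < e%:E)%E ->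
  nrm2 (re f) < e /\ nrm2 (im f) < e.
Proof.
move=> /l2P[l1 l2]; rewrite sqnormE// lte_fin => h.
by have := nrm2_ge0 l1; have := nrm2_ge0 l2; split; lra.
Qed.

Variables a b : nat -> R.

Lemma re_tau f : re (tau a b f) = rtau a b (re f).
Proof.
by apply/funext => -[|n]; rewrite /re /= !ReD !ReM_real.
Qed.

Lemma im_tau f : im (tau a b f) = rtau a b (im f).
Proof.
by apply/funext => -[|n]; rewrite /im /= !ImD !ImM_real.
Qed.

Lemma fsuppP f : finitely_supported f <-> finsupp (re f) /\ finsupp (im f).
Proof.
split=> [[N fN]|[[N fN] [P fP]]].
  by split; exists N => n /fN; rewrite /re /im => ->.
exists (maxn N P) => n; rewrite geq_max => /andP[/fN + /fP].
by rewrite /re /im; case: (f n) => ? ? /= -> ->.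
Qed.

Lemma JminP (p : (nat -> R[i]) * (nat -> R[i])) : Jmin a b p ->
  [/\ finsupp (re p.1), finsupp (im p.1), re p.2 = rtau a b (re p.1) &
      im p.2 = rtau a b (im p.1)].
Proof. by move=> [/fsuppP[? ?] ->]; rewrite re_tau im_tau. Qed.

Lemma op_closureP (p : (nat -> R[i]) * (nat -> R[i])) :
  op_closure (Jmin a b) p <->
  clos a b (re p.1) (re p.2) /\ clos a b (im p.1) (im p.2).
Proof.
split=> [[lp1 lp2 h]|[[l1 l1' h] [l2 l2' h']]].
  have [[l11 l12] [l21 l22]] := ((l2P _).1 lp1, (l2P _).1 lp2).
  have {}h e : 0 < e -> exists f k : nat -> R, [/\ finsupp f /\ finsupp k,
      nrm2 (re p.1 - f) < e /\ nrm2 (im p.1 - k) < e &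
      nrm2 (re p.2 - rtau a b f) < e /\ nrm2 (im p.2 - rtau a b k) < e].
    move=> /h[q [/JminP[fr fi er ei] h1 h2]]; exists (re q.1), (im q.1); split=> //.
      rewrite -re_sub -im_sub; apply: sqnorm_lt h1; apply/l2P.
      by rewrite re_sub im_sub; split; apply: l2rB => //; exact: finsupp_l2r.
    rewrite -er -ei -re_sub -im_sub; apply: sqnorm_lt h2; apply/l2P.
    rewrite re_sub im_sub er ei.
    by split; apply: l2rB => //; exact/finsupp_l2r/finsupp_rtau.
  by split; split => // e /h[f [k [[ff fk] [h1 h2] [h3 h4]]]]; [exists f|exists k].
split; [exact/l2P|exact/l2P|] => e e0.
have e20 : 0 < e / 2 by rewrite divr_gt0.
have [[f [ff h1 h2]] [k [fk h3 h4]]] := (h _ e20, h' _ e20).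
exists (cseq f k, tau a b (cseq f k)); split.
- by split => //=; apply/fsuppP.
- rewrite sqnormE ?re_sub ?im_sub /=.
  + by rewrite lte_fin (splitr e) ltrD.
  + by apply: l2rB => //; exact: finsupp_l2r.
  + by apply: l2rB => //; exact: finsupp_l2r.
- rewrite sqnormE ?re_sub ?im_sub /= ?re_tau ?im_tau.
  + by rewrite lte_fin (splitr e) ltrD.
  + by apply: l2rB => //; exact/finsupp_l2r/finsupp_rtau.
  + by apply: l2rB => //; exact/finsupp_l2r/finsupp_rtau.
Qed.

(** Self-adjointness is tested on sequences with zero imaginary part, for which the real part of the
    complex inner product is [dot]. *)
Lemma limit_point_sym : limit_point_case a b -> sym_graph (clos a b).
Proof.
rewrite /limit_point_case /selfadjoint => sa x y x' y' xy xy'.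
have clos0 : clos a b 0 0.
  have := clos_lin (-1) xy xy; by rewrite !scaleN1r !subrr.
have [lx ly _] := xy; have [lx' ly' _] := xy'.
have : op_closure (Jmin a b) (cseq x' 0, cseq y' 0) by apply/op_closureP.
rewrite -sa => -[_ _ /(_ (cseq x 0, cseq y 0))].
have h : op_closure (Jmin a b) (cseq x 0, cseq y 0) by apply/op_closureP.
move=> /(_ h) /=; rewrite !innerE; try by apply: cseq_l2 => //; exact: l2r0.
rewrite !re_cseq !im_cseq => -[+ _].
have dot00 : dot (0 : nat -> R) 0 = 0 by exact: nrm20.
by rewrite !dot00 !addr0.
Qed.

(** Used through its contrapositive, to extract a pair with nonzero boundary form in the limit
    circle case. Testing an adjoint pair on basis vectors gives [y = tau x], so both parts of [x]
    lie in the maximal domain and [dmax_clos] applies; the reverse inclusion is the assumed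
    symmetry. *)
Lemma dmax_sym_limit_point :
  (forall f k : nat -> R, dmax a b f -> dmax a b k ->
    dot f (rtau a b k) = dot (rtau a b f) k) ->
  limit_point_case a b.
Proof.
move=> sym; apply/seteqP; split => -[x y].
  move=> [/= lx ly h]; have [[lx1 lx2] [ly1 ly2]] := ((l2P _).1 lx, (l2P _).1 ly).
  have hb n : re y n = rtau a b (re x) n /\ im y n = rtau a b (im x) n.
    have fb := finsupp_basis (R := R) n.
    have c0 : clos a b 0 0.
      have := clos_lin (-1) (finsupp_clos a b fb) (finsupp_clos a b fb).
      by rewrite !scaleN1r !subrr.
    have := h (cseq (basis n) 0, cseq (rtau a b (basis n)) 0).
    have hc : op_closure (Jmin a b) (cseq (basis n) 0, cseq (rtau a b (basis n)) 0).
      by apply/op_closureP; split => //; exact: finsupp_clos.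
    have lb : l2r (rtau a b (basis n)) by exact/finsupp_l2r/finsupp_rtau.
    move=> /(_ hc) /=; rewrite !innerE//; last 2 first.
    - by apply: cseq_l2; [exact: l2r_basis|exact: l2r0].
    - by apply: cseq_l2; [|exact: l2r0].
    rewrite !re_cseq !im_cseq.
    have d0 z : dot (0 : nat -> R) z = 0.
      apply: dot_sums; rewrite (_ : (fun=> _) = fun=> 0).
        by have := @sums_fin R (fun=> 0) 0 (fun _ _ => erefl); rewrite big_geq.
      by apply/funext => i; rewrite mul0r.
    rewrite !d0 !addr0 !sub0r !(dotC (rtau a b _)) !dot_rtau_basis !dot_basis.
    by move=> -[-> /oppr_inj ->].
  have e1 : re y = rtau a b (re x) by apply/funext => n; case: (hb n).
  have e2 : im y = rtau a b (im x) by apply/funext => n; case: (hb n).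
  apply/op_closureP => /=; rewrite e1 e2.
  split; apply: dmax_clos => //; by split => //; rewrite -?e1 -?e2.
move=> /op_closureP[/= h1 h2]; have [lx1 ly1 _] := h1; have [lx2 ly2 _] := h2.
split => //=; [exact/l2P|exact/l2P|] => -[x' y'] /op_closureP[/= h1' h2'].
have [lx1' ly1' _] := h1'; have [lx2' ly2' _] := h2'.
have dmx u v : clos a b u v -> dmax a b u /\ v = rtau a b u.
  by move=> h; have e := clos_rtau h; move: h; rewrite {1}e => -[].
have {}sym : sym_graph (clos a b).
  move=> u v u' v' /dmx[du ->] /dmx[du' ->].
  by rewrite sym.
rewrite !innerE; try by apply/l2P.
by rewrite (sym _ _ _ _ h1' h1) (sym _ _ _ _ h2' h2) (sym _ _ _ _ h2' h1)
  (sym _ _ _ _ h1' h2).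
Qed.

End ComplexToReal.

(** * Boundary conditions at infinity and symmetry of [J(g)] *)

Section BoundaryCondition.
Context {R : realType}.

Lemma angle_range (g : option R) al : is_angle g al -> 0 <= al < pi.
Proof.
case: g => [r [/andP[h1 h2] _]|->]; first by rewrite ltW.
by rewrite lexx pi_gt0.
Qed.

Lemma sinB_eq0 (al be : R) : 0 <= al < pi -> 0 <= be < pi ->
  sin (al - be) = 0 -> al = be.
Proof.
wlog lt_ba : al be / be < al => [hw|/andP[a0 a1] /andP[b0 b1] s0].
  move=> ha hb h; have [ab|ba|//] := ltgtP al be; last exact: hw.
  by apply/esym/hw => //; rewrite -opprB sinN h oppr0.
have : 0 < sin (al - be) by apply: sin_gt0_pi; apply/andP; split; lra.
by rewrite s0 ltxx.
Qed.

Lemma angle_unique (g : option R) al be :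
  is_angle g al -> is_angle g be -> al = be.
Proof.
move=> ha hb; apply: sinB_eq0; [exact: angle_range ha|exact: angle_range hb|].
case: g ha hb => [r [ha ->] [hb e]|-> ->]; last by rewrite subrr sin0.
have sa : sin al != 0 by rewrite gt_eqF// sin_gt0_pi.
have sb : sin be != 0 by rewrite gt_eqF// sin_gt0_pi.
have {}e : cos al * sin be = cos be * sin al.
  by rewrite -[cos al](divfK sa) e; field.
by rewrite sinB e mulrC subrr.
Qed.

Lemma angle_inj (g g' : option R) al : is_angle g al -> is_angle g' al -> g = g'.
Proof.
case: g g' => [r|] [r'|] //=.
- by move=> [_ ->] [_ ->].
- by move=> [/andP[h _] _] h'; rewrite h' ltxx in h.
- by move=> h' [/andP[h _] _]; rewrite h' ltxx in h.
Qed.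

Lemma angle_exists (g : option R) : exists al, is_angle g al.
Proof.
case: g => [r|]; last by exists 0.
(* The angle is [acos (r / q)], whose sine is [1 / q], so that its cotangent is [r]. *)
pose q := Num.sqrt (1 + r ^+ 2).
have q2 : q ^+ 2 = 1 + r ^+ 2 by rewrite sqr_sqrtr// addr_ge0// sqr_ge0.
have q0 : 0 < q by rewrite sqrtr_gt0 ltr_wpDr// sqr_ge0.
have rq : -1 < r / q < 1.
  rewrite -ltr_norml normrM normfV (gtr0_norm q0) ltr_pdivrMr// mul1r.
  by rewrite -(@ltr_pXn2r _ 2) ?nnegrE ?(ltW q0)// real_normK ?num_real// q2; lra.
have /andP[rq1 rq2] := rq.
have rq' : -1 <= r / q <= 1 by rewrite !ltW.
exists (acos (r / q)); split.
  by rewrite acos_gt0 ?acos_ltpi// ?(ltW rq1)// ?(ltW rq2) ?rq1 ?rq2.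
rewrite acosK ?in_itv//= sin_acos// (_ : 1 - _ = q^-1 ^+ 2); last first.
  by rewrite expr_div_n exprVn q2; field; rewrite gt_eqF// -q2 exprn_gt0.
by rewrite sqrtr_sqr gtr0_norm ?invr_gt0// invrK divfK// gt_eqF.
Qed.

Variables a b : nat -> R.
Hypothesis b_gt0 : forall n, 0 < b n.

Lemma zero_sol_rtau x y n : (0 < n)%N -> rtau a b (zero_sol a b x y) n = 0.
Proof. by case: n => // n _; have [_ _ h] := zero_solP a x y b_gt0; exact: h. Qed.

Lemma limit_circle_l2 : limit_circle_case a b -> l2r (c0 a b) /\ l2r (s0 a b).
Proof.
move=> lc; have [f [k [df dk fk]]] : exists f k, [/\ dmax a b f, dmax a b k &
    dot f (rtau a b k) <> dot (rtau a b f) k].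
  apply: contrapT => h; apply/lc/dmax_sym_limit_point => f k df dk.
  by apply: contrapT => fk; apply: h; exists f, k.
by split; apply: (weyl_l2 df dk fk) => n; exact: zero_sol_rtau.
Qed.

Lemma v_E al : v_ a b al = cos al *: c0 a b + sin al *: s0 a b.
Proof. by []. Qed.

Lemma wr_c0s0 n : wr b (c0 a b) (s0 a b) n = b 0%N.
Proof.
elim: n => [|n IH]; first by rewrite /wr /c0 /s0 /zero_sol /=; ring.
by rewrite (wrS a) IH !zero_sol_rtau// !mulr0 subrr addr0.
Qed.

Lemma wr_v al be n : wr b (v_ a b al) (v_ a b be) n = b 0%N * sin (be - al).
Proof.
by rewrite -(wr_c0s0 n) sinB /wr /v_; ring.
Qed.

Lemma v_rtau al n : (0 < n)%N -> rtau a b (v_ a b al) n = 0.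
Proof.
move=> n0; rewrite v_E rtau_lin rtauZ !fctE.
by rewrite !zero_sol_rtau// !scaler0 addr0.
Qed.

Lemma v_dmax al : limit_circle_case a b -> dmax a b (v_ a b al).
Proof.
move=> /limit_circle_l2[lc ls]; split; last first.
  by apply: (@l2r_fin _ _ 1) => n; exact: v_rtau.
by rewrite v_E; apply: l2rD; exact: l2rZ.
Qed.

Definition rJg g (x y : nat -> R) : Prop :=
  (limit_point_case a b /\ clos a b x y) \/
  [/\ limit_circle_case a b, dmax a b x, y = rtau a b x &
      exists2 al, is_angle g al & wr b (v_ a b al) x @ \oo --> (0 : R)].

Lemma rJg_dmax g x y : rJg g x y -> dmax a b x /\ y = rtau a b x.
Proof.
move=> [[_ h]|[_ dx e _]] //; have e := clos_rtau h.
by move: h; rewrite {1}e => -[lx ly _].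
Qed.

Lemma rJg_fin g x : finsupp x -> rJg g x (rtau a b x).
Proof.
move=> fx; have [lp|lc] := pselect (limit_point_case a b).
  by left; split => //; exact: finsupp_clos.
right; split => //; first exact: finsupp_dmax.
have [al hal] := angle_exists g; exists al => //.
have [N xN] := fx; apply: cvg_near_cst; exists N => // n /= Nn.
by rewrite /wr !xN ?mulr0 ?mul0r ?subrr ?mulr0// leqW.
Qed.

Lemma wr_linr f x y t n : wr b f (x + t *: y) n = wr b f x n + t * wr b f y n.
Proof. by rewrite /wr !fctE /GRing.scale /=; ring. Qed.

Lemma rJg_lin g : lin_graph (rJg g).
Proof.
move=> t x y x' y' [[lp h]|[lc dx ey [al hal hx]]].
  by move=> [[_ h']|[/(_ lp)//]]; left; split => //; exact: clos_lin.
move=> [[/lc//]|[_ dx' ey' [be hbe hx']]]; right; split => //.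
- exact: dmax_lin.
- by rewrite rtau_lin ey ey'.
- exists al => //; rewrite (angle_unique hbe hal) in hx'.
  rewrite (_ : wr _ _ _ = fun n => wr b (v_ a b al) x n + t * wr b (v_ a b al) x' n).
    rewrite -[X in _ --> X]addr0 -[X in _ --> _ + X](mulr0 t).
    by apply: cvgD => //; apply: cvgMl_tmp.
  by apply/funext => n; exact: wr_linr.
Qed.

(** In the limit circle case the boundary form is controlled by a Pluecker relation: with
    [v = v_alpha] and [w = v_(alpha + pi/2)], whose Wronskian is the constant [b 0], [b 0 * W(x, x')
    = W(v, x) W(w, x') - W(v, x') W(w, x)]. The factors with [v] tend to 0 and those with [w]
    converge, as [w] is in the maximal domain. *)
Lemma rJg_sym g : sym_graph (rJg g).
Proof.
move=> x y x' y' [[lp h]|[lc dx ey [al hal hx]]].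
  by move=> [[_ h']|[/(_ lp)//]]; exact: limit_point_sym h h'.
move=> [[/lc//]|[_ dx' ey' [be hbe hx']]].
rewrite (angle_unique hbe hal) in hx'.
pose w := v_ a b (al + pi / 2).
have dw : dmax a b w by exact: v_dmax.
have h : wr b x x' @ \oo --> (0 : R).
  rewrite (_ : wr b x x' = fun n => (b 0%N)^-1 *
      (wr b (v_ a b al) x n * wr b w x' n - wr b (v_ a b al) x' n * wr b w x n)).
    set L := dot w (rtau a b x') - dot (rtau a b w) x'.
    set L' := dot w (rtau a b x) - dot (rtau a b w) x.
    rewrite (_ : 0 = (b 0%N)^-1 * (0 * L - 0 * L')); last by ring.
    by apply: cvgMl_tmp; apply: cvgB; apply: cvgM => //; exact: wr_cvg.
  apply/funext => n; have b0 : b 0%N != 0 by rewrite gt_eqF.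
  have := wr_v al (al + pi / 2) n.
  rewrite addrAC subrr add0r sin_pihalf mulr1 -/w => e.
  apply: (mulfI b0); rewrite mulVKf// -e /wr; ring.
have := wr_cvg dx dx' => /(cvg_unique _ h)/esym/eqP.
by rewrite subr_eq0 -ey' -ey => /(_ (@Rhausdorff R)) /eqP ->.
Qed.

Local Open Scope complex_scope.

Lemma JgP g (p : (nat -> R[i]) * (nat -> R[i])) :
  Jg a b g p <-> rJg g (re p.1) (re p.2) /\ rJg g (im p.1) (im p.2).
Proof.
have reW al n : complex.Re (wronskian b (fun j => (v_ a b al j)%:C) p.1 n) =
    wr b (v_ a b al) (re p.1) n.
  rewrite /wronskian ReM_real ReD ReN ReM_real [_ * (v_ _ _ _ _)%:C]mulrC.
  by rewrite ReM_real /wr /re; ring.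
have imW al n : complex.Im (wronskian b (fun j => (v_ a b al j)%:C) p.1 n) =
    wr b (v_ a b al) (im p.1) n.
  rewrite /wronskian ImM_real ImD ImN ImM_real [_ * (v_ _ _ _ _)%:C]mulrC.
  by rewrite ImM_real /wr /im; ring.
split=> [[[lp /op_closureP[h1 h2]]|[lc [lx ltx ->] [al hal h]]]|].
- by split; left.
- have [l1 l2] := (l2P _).1 lx; have [l3 l4] := (l2P _).1 ltx.
  rewrite re_tau in l3 *; rewrite im_tau in l4 *.
  split; right; split => //; exists al => //; apply/cvgr0Pnorm_lt => e e0;
    have /cvgr0Pnorm_lt/(_ e e0) := h; apply: filterS => n; apply: le_lt_trans;
    rewrite [leRHS]ger0_norm ?sqrtr_ge0// -sqrtr_sqr ler_wsqrtr// -?reW -?imW;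
    by rewrite ?lerDl ?lerDr sqr_ge0.
move=> [[[lp h]|[lc [l1 l3] e [al hal h]]]].
  by move=> [[_ h']|[/(_ lp)//]]; left; split => //; exact/op_closureP.
move=> [[/lc//]|[_ [l2 l4] e' [be hbe h']]]; right; split => //.
  split; [exact/l2P|by apply/l2P; rewrite re_tau im_tau|].
  by apply: cseq_inj; rewrite ?re_tau ?im_tau.
exists al => //; rewrite (angle_unique hbe hal) in h'.
have hs : (fun n => `|wr b (v_ a b al) (re p.1) n| +
    `|wr b (v_ a b al) (im p.1) n|) @ \oo --> (0 : R).
  rewrite -[X in _ --> X]addr0 -[X in _ --> X + X](normr0 R).
  by apply: cvgD; exact: cvg_norm.
apply: (squeeze_cvgr (f := fun=> 0) _ _ hs); last exact: cvg_cst.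
apply: nearW => n.
rewrite sqrtr_ge0/= -[leRHS]ger0_norm ?addr_ge0//= -sqrtr_sqr ler_wsqrtr//.
rewrite -reW -imW; set u := complex.Re _; set v := complex.Im _.
rewrite sqrrD !real_normK ?num_real// lerD2r lerDl mulrn_wge0// mulr_ge0//.
Qed.

End BoundaryCondition.

(** * The operators with a condition at the origin and their resolvents at real points *)

Section RealResolvent.
Local Open Scope complex_scope.
Context {R : realType}.
Variables a b : nat -> R.
Hypothesis b_gt0 : forall n, 0 < b n.
Variable g : option R.
Implicit Types x y u w : nat -> R.

Definition rJh h x y : Prop := rJg a b g x (y + (h * x 0%N) *: basis 0).

Lemma JhgP h (p : (nat -> R[i]) * (nat -> R[i])) :
  Jhg a b g h p <-> rJh h (re p.1) (re p.2) /\ rJh h (im p.1) (im p.2).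
Proof.
pose q := (p.1, fun n : nat =>
  p.2 n + (if n == 0%N then h%:C * p.1 0%N else 0)).
have -> : Jhg a b g h p = Jg a b g q by [].
have e1 : re q.2 = re p.2 + (h * re p.1 0%N) *: basis 0.
  apply/funext => n; rewrite fctE /q /re /= ReD /basis; congr (_ + _).
  case: n => [|n] /=; first by rewrite ReM_real [RHS]mulr1.
  by rewrite [RHS]mulr0.
have e2 : im q.2 = im p.2 + (h * im p.1 0%N) *: basis 0.
  apply/funext => n; rewrite fctE /q /im /= ImD /basis; congr (_ + _).
  case: n => [|n] /=; first by rewrite ImM_real [RHS]mulr1.
  by rewrite [RHS]mulr0.
by rewrite /rJh -e1 -e2; exact: JgP q.
Qed.

Lemma rJh_tau h x y : rJh h x y -> y = rtau a b x - (h * x 0%N) *: basis 0.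
Proof. by move=> /rJg_dmax[_ <-]; rewrite addrK. Qed.

Lemma rJh_dmax h x y : rJh h x y -> dmax a b x.
Proof. by move=> /rJg_dmax[]. Qed.

Lemma rJh_l2 h : l2_dom (rJh h).
Proof.
move=> x y xy; have [lx ltx] := rJh_dmax xy; split=> //.
by rewrite (rJh_tau xy); apply: l2rB => //; apply: l2rZ; exact: l2r_basis.
Qed.

Lemma rJh_lin h : lin_graph (rJh h).
Proof.
move=> t x y x' y' xy xy'; have := rJg_lin t xy xy'; rewrite /rJh; congr rJg.
by apply/funext => n; rewrite !fctE /GRing.scale /=; ring.
Qed.

Lemma rJhB h x y x' y' : rJh h x y -> rJh h x' y' -> rJh h (x - x') (y - y').
Proof. by move=> xy xy'; have := rJh_lin (-1) xy xy'; rewrite !scaleN1r. Qed.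

Lemma rJhZ h t x y : rJh h x y -> rJh h (t *: x) (t *: y).
Proof.
move=> xy; have := rJh_lin (t - 1) xy xy.
by rewrite !scalerBl !scale1r ![_ + (_ - _)]addrC !subrK.
Qed.

Lemma rJh_sym h : sym_graph (rJh h).
Proof.
move=> x y x' y' xy xy'; have := rJg_sym b_gt0 xy xy'.
have [[lx ly] [lx' ly']] := (rJh_l2 xy, rJh_l2 xy').
have lb : l2r (basis 0 : nat -> R) by exact: l2r_basis.
rewrite dotDl ?dotDr ?dotZl ?dotZr//; try exact: l2rZ.
by rewrite (dotC x (basis 0)) !dot_basis; lra.
Qed.

Lemma rJh_basis h k :
  rJh h (basis k) (rtau a b (basis k) - (h * basis k 0%N) *: basis 0).
Proof. by rewrite /rJh subrK; apply: rJg_fin; exact: finsupp_basis. Qed.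

Lemma rJh_change h h' x y : rJh h x y ->
  rJh h' x (y - ((h' - h) * x 0%N) *: basis 0).
Proof.
rewrite /rJh; congr rJg; apply/funext => n; rewrite !fctE /GRing.scale /=; ring.
Qed.

(** The off-diagonal entries do not vanish, so the recurrence determines an eigenvector from its
    first entry. *)
Lemma rJh_eig_unique h lam u w : rJh h u (lam *: u) -> rJh h w (lam *: w) ->
  u 0%N = w 0%N -> u = w.
Proof.
move=> Tu Tw uw0; have /rJh_tau := rJhB Tu Tw.
set d := u - w; have d0 : d 0%N = 0 by rewrite /d fctE uw0 subrr.
rewrite d0 mulr0 scale0r subr0 -scalerBr -/d => e.
suff h0 n : d n = 0 /\ d n.+1 = 0.
  by apply/funext => n; apply/eqP; rewrite -subr_eq0; have [<- _] := h0 n.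
have bn m : b m != 0 by rewrite gt_eqF.
elim: n => [|n [dn dn1]]; split => //.
  have := congr1 (fun z => z 0%N) e; rewrite fctE /= d0 scaler0 mulr0 add0r.
  by move/esym/eqP; rewrite mulf_eq0 (negPf (bn _)) => /eqP.
have := congr1 (fun z => z n.+1) e; rewrite fctE /= dn dn1 scaler0 !mulr0 !add0r.
by move/esym/eqP; rewrite mulf_eq0 (negPf (bn _)) => /eqP.
Qed.

(* For real [s], the bound on solutions makes uniqueness automatic. *)
Definition rres h s : Prop :=
  (forall y, l2r y -> exists x, rJh h x (y + s *: x)) /\
  exists C, forall x y, rJh h x y -> nrm2 x <= C * nrm2 (y - s *: x).

Lemma re_shift (f k : nat -> R[i]) (s : R) :
  re (fun n => f n + s%:C * k n) = re f + s *: re k.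
Proof. by apply/funext => n; rewrite /re ReD ReM_real. Qed.

Lemma im_shift (f k : nat -> R[i]) (s : R) :
  im (fun n => f n + s%:C * k n) = im f + s *: im k.
Proof. by apply/funext => n; rewrite /im ImD ImM_real. Qed.

Lemma rJh0 h : rJh h 0 0.
Proof. by have := rJhB (rJh_basis h 0) (rJh_basis h 0); rewrite !subrr. Qed.

Lemma resolventP h s : resolvent_set (Jhg a b g h) s%:C <-> rres h s.
Proof.
have l0 := @l2r0 R.
split=> [[C hC]|[surj [C hC]]].
  have surj y : l2r y -> exists2 x, rJh h x (y + s *: x) & nrm2 x <= C * nrm2 y.
    move=> ly; have [x [/JhgP[/= h1 h1'] _ h2]] := hC _ (cseq_l2 ly l0).
    have [[lx1 _] [lx2 _]] := (rJh_l2 h1, rJh_l2 h1').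
    exists (re x); first by move: h1; rewrite re_shift.
    move: h2; rewrite !sqnormE ?re_cseq ?im_cseq// nrm20 addr0 lee_fin.
    by apply: le_trans; rewrite lerDl nrm2_ge0.
  have inj d : rJh h d (s *: d) -> d = 0.
    move=> hd; have [x [_ xU _]] := hC _ (cseq_l2 l0 l0).
    have e z : rJh h z (s *: z) -> cseq z 0 = x.
      move=> hz; apply: xU; apply/JhgP; rewrite /= re_shift im_shift.
      rewrite !re_cseq !im_cseq add0r scaler0 addr0; split => //; exact: rJh0.
    have := e 0; rewrite scaler0 => /(_ (rJh0 h)) e0.
    by have := congr1 re (e _ hd); rewrite -e0 !re_cseq.
  split; first by move=> y /surj[x hx _]; exists x.
  exists C => x y xy; have [lx ly] := rJh_l2 xy.
  have [|x' hx' bx'] := surj (y - s *: x); first by apply: l2rB => //; exact: l2rZ.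
  suff e : x' = x by rewrite -{1}e.
  apply/eqP; rewrite -subr_eq0; apply/eqP/inj.
  have := rJhB hx' xy; congr rJh.
  by apply/funext => n; rewrite !fctE /GRing.scale /=; ring.
exists C => y ly; have [ly1 ly2] := (l2P _).1 ly.
have [[x1 h1] [x2 h2]] := (surj _ ly1, surj _ ly2).
have [[lx1 _] [lx2 _]] := (rJh_l2 h1, rJh_l2 h2).
have inj u v w : rJh h u (w + s *: u) -> rJh h v (w + s *: v) -> u = v.
  move=> hu hv; have huv := rJhB hu hv; apply/eqP; rewrite -subr_eq0; apply/eqP.
  apply: nrm2_eq0; first by case: (rJh_l2 huv).
  apply: le_trans (hC _ _ huv) _.
  rewrite (_ : _ - _ = 0) ?nrm20 ?mulr0//.
  by rewrite scalerBr opprD addrACA subrr add0r subrr.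
exists (cseq x1 x2); split.
- by apply/JhgP; rewrite /= re_shift im_shift.
- move=> x' /JhgP[/=]; rewrite re_shift im_shift => h1' h2'.
  by apply: cseq_inj; rewrite ?re_cseq ?im_cseq; [exact: inj h1' h1|exact: inj h2' h2].
- rewrite !sqnormE ?re_cseq ?im_cseq// lee_fin mulrDr lerD//.
  + by have := hC _ _ h1; rewrite addrK.
  + by have := hC _ _ h2; rewrite addrK.
Qed.

(** The eigenvector normalized by 1 at the origin is real: its imaginary part solves the same
    eigenvalue equation and vanishes at the origin. *)
Lemma norming_constantP h lam gam : norming_constant (Jhg a b g h) lam gam ->
  exists u, [/\ rJh h u (lam *: u), u 0%N = 1 & gam = (nrm2 u)^-1].
Proof.
move=> [u [/JhgP[/= h1 h2] u0 ->]]; exists (re u).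
have reZ : re (fun n => lam%:C * u n) = lam *: re u.
  by apply/funext => n; rewrite /re ReM_real.
have imZ : im (fun n => lam%:C * u n) = lam *: im u.
  by apply/funext => n; rewrite /im ImM_real.
rewrite reZ in h1; rewrite imZ in h2.
have i0 : im u = 0.
  apply: (@rJh_eig_unique h lam _ 0 h2); last by rewrite /im u0.
  by rewrite scaler0; exact: rJh0.
have [lu _] := rJh_l2 h1; split => //; first by rewrite /re u0.
rewrite sqnormE ?i0//; last exact: l2r0.
by rewrite nrm20 addr0.
Qed.

End RealResolvent.

(** * Eigenfunction expansion *)

Section Expansion.
Context {R : realType}.
Variables a b : nat -> R.
Hypothesis b_gt0 : forall n, 0 < b n.
Variables (g : option R) (h1 h2 : R).
Hypothesis h12 : h1 != h2.
Variables (M : set int) (lam : int -> R) (u : int -> nat -> R).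
Notation T1 := (rJh a b g h1).
Hypothesis eig : forall n, M n -> T1 (u n) (lam n *: u n).
Hypothesis u0 : forall n, M n -> u n 0%N = 1.
Hypothesis lam_inj : forall m n, M m -> M n -> m != n -> lam m != lam n.
Hypothesis res1 : forall s, (forall n, M n -> s != lam n) -> rres a b g h1 s.
Hypothesis res2 : forall n, M n -> rres a b g h2 (lam n).
Hypothesis lam_proper : forall r : R, exists K, forall n, M n -> (K < `|n|)%N ->
  r <= `|lam n|.
Implicit Types (x y z w : nat -> R) (F : seq int).

Let l2u n : M n -> l2r (u n).
Proof. by move=> /eig /rJh_l2[]. Qed.

Let u_gt0 n : M n -> 0 < nrm2 (u n).
Proof.
by move=> Mn; apply: (@nrm2_gt0 _ _ 0%N); [exact: l2u|rewrite u0// oner_eq0].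
Qed.

Lemma dot_eig n x y : M n -> T1 x y -> dot (u n) y = lam n * dot (u n) x.
Proof.
move=> Mn xy; rewrite dotC (rJh_sym b_gt0 xy (eig Mn)).
by rewrite dotZr ?(dotC x)//; [exact: l2u|case: (rJh_l2 xy)].
Qed.

Lemma eig_ortho m n : M m -> M n -> m != n -> dot (u m) (u n) = 0.
Proof.
move=> Mm Mn mn;  have lm := l2u Mm; have ln := l2u Mn.
have := dot_eig Mm (eig Mn); rewrite dotZr// => /eqP.
rewrite -subr_eq0 -mulrBl mulf_eq0 subr_eq0.
by rewrite eq_sym (negPf (lam_inj Mm Mn mn)) => /eqP.
Qed.

(* [lam n] is not in the spectrum of the rank one perturbation at [h2]; solving
   there for data orthogonal to [u n] produces a solution vanishing at the origin,
   on which both operators agree. *)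
Lemma bounded_below_eig n : M n -> exists C, forall x y, T1 x y ->
  dot (u n) x = 0 -> nrm2 x <= C * nrm2 (y - lam n *: x).
Proof.
move=> Mn; have [surj [C hC]] := res2 Mn; exists C => x y xy ux0.
have [lx ly] := rJh_l2 xy; have lu := l2u Mn.
set w := y - lam n *: x.
have lw : l2r w by apply: l2rB => //; exact: l2rZ.
have uw : dot (u n) w = 0.
  by rewrite dotBr ?dotZr ?(dot_eig Mn xy) ?subrr//; exact: l2rZ.
have [q hq] := surj _ lw; have [lq lqw] := rJh_l2 hq.
have hq1 := rJh_change h1 hq.
(* Pairing the equation for [q] with [u n] cancels all terms but [(h1 - h2) * q 0]. *)
have q0 : q 0%N = 0.
  have := dot_eig Mn hq1.
  have le0 : l2r (basis 0 : nat -> R) by exact: l2r_basis.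
  rewrite (dotBr lqw (l2rZ _ le0) lu) (dotDr lw (l2rZ _ lq) lu) !dotZr//.
  rewrite uw add0r (dotC _ (basis 0)) dot_basis u0// mulr1.
  move=> /eqP; rewrite -subr_eq0 addrAC subrr add0r oppr_eq0 mulf_eq0.
  by rewrite subr_eq0 (negPf h12) => /eqP.
rewrite q0 mulr0 scale0r subr0 in hq1.
have hd : T1 (q - x) (lam n *: (q - x)).
  have := rJhB hq1 xy; congr (rJh _ _ _ _ _ _).
  by apply/funext => i; rewrite /w !fctE /GRing.scale /=; ring.
(* [q] and [x] differ by a multiple of [u n], which is orthogonal to [x]; hence the norm of [x] is
   at most that of [q], which the resolvent at [h2] bounds. *)
have e : q = x + (q - x) 0%N *: u n.
  rewrite -(@rJh_eig_unique _ _ _ b_gt0 _ _ _ _ ((q - x) 0%N *: u n) hd).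
  - by rewrite addrC subrK.
  - by rewrite scalerA mulrC -scalerA; apply: rJhZ; exact: eig.
  - by rewrite -[RHS]/((q - x) 0%N * u n 0%N) u0// mulr1.
have := hC _ _ hq; rewrite addrK; apply: le_trans.
rewrite [in leRHS]e nrm2D ?nrm2Z ?dotZr// 1?dotC ?ux0; try exact: l2rZ.
by rewrite !mulr0 addr0 lerDl mulr_ge0 ?sqr_ge0 ?nrm2_ge0.
Qed.

Definition gmf n : R := if n \in M then (nrm2 (u n))^-1 else 0.

Let gmfE n : M n -> gmf n = (nrm2 (u n))^-1.
Proof. by move=> Mn; rewrite /gmf mem_set. Qed.

(** For duplicate-free [F] inside [M], the orthogonal projection onto the span of the [u i]. *)
Definition eproj F x : nat -> R :=
  \sum_(i <- F) (gmf i * dot (u i) x) *: u i.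

Let inM F := forall i, i \in F -> M i.

Let inM_cons i F : inM (i :: F) -> M i /\ inM F.
Proof.
by move=> h; split=> [|j jF]; apply: h; rewrite inE ?eqxx// jF orbT.
Qed.

Lemma eproj_l2 F x : inM F -> l2r (eproj F x).
Proof.
elim: F => [|i F IH] FM; rewrite /eproj ?big_nil ?big_cons; first exact: l2r0.
have [Mi /IH lF] := inM_cons FM.
by apply: l2rD => //; apply: l2rZ; exact: l2u.
Qed.

Lemma dot_eproj F x z : inM F -> l2r z ->
  dot (eproj F x) z = \sum_(i <- F) gmf i * dot (u i) x * dot (u i) z.
Proof.
move=> + lz; elim: F => [|i F IH] FM; rewrite /eproj ?big_nil ?big_cons.
  by rewrite -(scale0r (0 : nat -> R)) dotZl ?mul0r//; exact: l2r0.
have [Mi MF] := inM_cons FM; have lu := l2u Mi.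
rewrite dotDl//; [|exact: l2rZ|exact: eproj_l2].
by rewrite dotZl// -/(eproj F x) IH.
Qed.

Lemma dot_eig_eproj F x j : uniq F -> inM F -> j \in F ->
  dot (u j) (eproj F x) = dot (u j) x.
Proof.
move=> uF FM jF; have Mj := FM _ jF; have lj := l2u Mj.
rewrite dotC dot_eproj//.
rewrite (bigD1_seq j)//= big_seq_cond big1 ?addr0.
  by rewrite gmfE// -/(nrm2 _) mulrAC mulVf ?mul1r// gt_eqF// u_gt0.
by move=> i /andP[iF ij]; rewrite eig_ortho ?mulr0//; exact: FM.
Qed.

Lemma eproj_graph F x y (mu : R) : inM F -> T1 x (y + mu *: x) ->
  T1 (eproj F x) (eproj F y + mu *: eproj F x).
Proof.
move=> + xy; have [lx lxy] := rJh_l2 xy.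
have ly : l2r y by rewrite -(addrK (mu *: x) y); apply: l2rB => //; exact: l2rZ.
elim: F => [|i F IH] FM; rewrite /eproj ?big_nil ?big_cons.
  by rewrite scaler0 addr0; exact: rJh0.
have [Mi MF] := inM_cons FM; have := rJh_lin (gmf i * dot (u i) x) (IH MF) (eig Mi).
have lu := l2u Mi.
have := dot_eig Mi xy; rewrite dotDr ?dotZr//; last exact: l2rZ.
rewrite -/(eproj F x) -/(eproj F y) => e; congr (rJh _ _ _ _ _ _).
  by rewrite addrC.
have -> : dot (u i) y = (lam i - mu) * dot (u i) x by rewrite mulrBl -e addrK.
by apply/funext => n; rewrite !fctE /GRing.scale /=; ring.
Qed.

Lemma nrm2_sub_eproj F x : uniq F -> inM F -> l2r x ->
  nrm2 (x - eproj F x) <= nrm2 x.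
Proof.
move=> uF FM lx; have lP := eproj_l2 x FM.
have lD : l2r (x - eproj F x) by exact: l2rB.
have h : dot (x - eproj F x) (eproj F x) = 0.
  rewrite dotC dot_eproj// big_seq big1// => i iF.
  have lu := l2u (FM _ iF).
  by rewrite dotBr// dot_eig_eproj// subrr mulr0.
have := nrm2D lD lP; rewrite subrK h mulr0 addr0 => ->.
by rewrite lerDl nrm2_ge0.
Qed.

(** [spectral_gap] for the operator shifted by [mu], on the orthogonal complement of the [u i] with
    [i] in [F]. The shift off the spectrum provides surjectivity. At [s + mu = lam n] with
    [|s| < r], the index [n] must lie in [F], and [bounded_below_eig] applies; at all other [s] the
    resolvent does. *)
Lemma eproj_gap F (mu r : R) x y : uniq F -> inM F ->
  (forall n, M n -> mu != lam n) ->
  (forall n, M n -> n \notin F -> r <= `|lam n - mu|) -> 0 < r ->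
  T1 x (y + mu *: x) -> r ^+ 2 * nrm2 (x - eproj F x) <= nrm2 y.
Proof.
move=> uF FM muM rF r0 xy; have [lx lxy] := rJh_l2 xy.
have ly : l2r y by rewrite -(addrK (mu *: x) y); apply: l2rB => //; exact: l2rZ.
pose V := [set z | l2r z /\ forall i, i \in F -> dot (u i) z = 0].
pose T z w := T1 z (w + mu *: z).
have Vsub z : l2r z -> V (z - eproj F z).
  move=> lz; split; first by apply: l2rB => //; exact: eproj_l2.
  move=> i iF; have lu := l2u (FM _ iF); have lP := eproj_l2 z FM.
  by rewrite dotBr// dot_eig_eproj// subrr.
have Tsub : T (x - eproj F x) (y - eproj F y).
  have := rJhB xy (eproj_graph FM xy); congr (rJh _ _ _ _ _ _).
  by apply/funext => n; rewrite !fctE /GRing.scale /=; ring.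
have dT : l2_dom T.
  move=> z w zw; have [lz lzw] := rJh_l2 zw; split => //.
  by rewrite -(addrK (mu *: z) w); apply: l2rB => //; exact: l2rZ.
apply: le_trans (nrm2_sub_eproj uF FM ly).
apply: (@spectral_gap _ T V) Tsub => //; try exact: Vsub.
- move=> t z w z' w' zw zw'; have := rJh_lin t zw zw'; congr (rJh _ _ _ _ _ _).
  by apply/funext => n; rewrite !fctE /GRing.scale /=; ring.
- move=> z w z' w' zw zw'; have [lz lw] := dT _ _ zw; have [lz' lw'] := dT _ _ zw'.
  have := rJh_sym b_gt0 zw zw'; rewrite dotDl ?dotDr ?dotZl ?dotZr//; try exact: l2rZ.
  exact: addIr.
- move=> t z w [lz Vz] [lw Vw]; split; first by apply: l2rD => //; exact: l2rZ.
  move=> i iF; have lu := l2u (FM _ iF).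
  by rewrite dotDr ?dotZr// ?Vz// ?Vw// ?mulr0 ?addr0//; exact: l2rZ.
- move=> w [lw Vw]; have [surj _] := res1 muM; have [z hz] := surj _ lw.
  have [lz _] := rJh_l2 hz.
  exists z => //; split => // i iF; have Mi := FM _ iF; have lu := l2u Mi.
  have := dot_eig Mi hz; rewrite dotDr ?dotZr// ?Vw// ?add0r; last exact: l2rZ.
  move=> /eqP; rewrite -subr_eq0 -mulrBl mulf_eq0 subr_eq0 (negPf (muM _ Mi)).
  by move=> /eqP.
- move=> s sr; have [[n [Mn e]]|h] := pselect (exists n, M n /\ lam n = s + mu).
    have nF : n \in F.
      by apply: contraLR sr => nF; rewrite -leNgt (le_trans (rF _ Mn nF))// e addrK.
    have [C hC] := bounded_below_eig Mn; exists C => z w [_ Vz] _ zw.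
    have := hC _ _ zw (Vz _ nF); rewrite e; congr (_ <= _ * nrm2 _).
    by apply/funext => i; rewrite !fctE /GRing.scale /=; ring.
  have [n Mn|_ [C hC]] := @res1 (s + mu).
    by apply/eqP => e; apply: h; exists n.
  exists C => z w _ _ zw; have := hC _ _ zw; congr (_ <= _ * nrm2 _).
  by apply/funext => n; rewrite !fctE /GRing.scale /=; ring.
Qed.

(* The residual of the projection of [basis k] onto the eigenvectors with
   [`|lam n| < r] has norm [O(1 / r)] because [basis k] lies in the domain. *)
Lemma eig_expansion (mu : R) k x : (forall n, M n -> mu != lam n) -> l2r x ->
  sums_along (@pickle_inv int) (fun n => gmf n * u n k * dot (u n) x) (x k).
Proof.
move=> muM lx; pose ek : nat -> R := basis k.
have lek : l2r ek by exact: l2r_basis.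
have Tek := rJh_basis a b g h1 k; rewrite -/ek in Tek.
set Y := _ - _ in Tek; pose Z := nrm2 (Y - mu *: ek).
have lY : l2r Y by case: (rJh_l2 Tek).
(* [Z] is the constant of the residual bound [Z / r ^+ 2]. The radius [r] chosen below makes
   [Z * nrm2 x / r ^+ 2 < e ^+ 2], using [r <= r ^+ 2]; [N0] exceeds the codes of all integers of
   absolute value at most [K]. *)
have Z0 : 0 <= Z by apply: nrm2_ge0; apply: l2rB => //; exact: l2rZ.
apply/cvgrPdist_lt => e e0.
pose r := (Z * nrm2 x + 1) / e ^+ 2 + 1.
have e2 : 0 < e ^+ 2 by rewrite exprn_gt0.
have D0 : 0 < Z * nrm2 x + 1 by rewrite ltr_wpDl// mulr_ge0// nrm2_ge0.
have r0 : 1 < r by rewrite ltrDr divr_gt0.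
have [K hK] := lam_proper (r + `|mu|).
pose N0 := \max_(i < K.*2.+1) (pickle (i%:Z - K%:Z)%R).+1.
have hN0 n : (`|n| <= K)%N -> (pickle n < N0)%N.
  move=> nK; have hi : (`|(n + K%:Z)%R| < K.*2.+1)%N by lia.
  apply: leq_trans (leq_bigmax (Ordinal hi)); rewrite /= ltnS.
  by rewrite (_ : _ - _ = n)//; lia.
exists N0 => // N /= N0N.
pose F := [seq n <- pmap (@pickle_inv int) (iota 0 N) | n \in M].
have FM : inM F by move=> i; rewrite mem_filter => /andP[/set_mem].
have uF : uniq F.
  by apply/filter_uniq/(pmap_uniq (@pickle_invK int)); exact: iota_uniq.
have FF n : M n -> n \notin F -> r <= `|lam n - mu|.
  move=> Mn nF; have : (K < `|n|)%N.
    rewrite ltnNge; apply: contra nF => /hN0 pn.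
    rewrite mem_filter mem_set//= mem_pmap; apply/mapP; exists (pickle n).
      by rewrite mem_iota /= add0n (leq_trans pn).
    by rewrite pickleK_inv.
  move=> /(hK _ Mn) h; have := ler_normD (lam n - mu) mu; rewrite subrK; lra.
have hw : r ^+ 2 * nrm2 (ek - eproj F ek) <= Z.
  apply: (@eproj_gap _ mu _ _ (Y - mu *: ek)) => //; last by rewrite subrK.
  exact: lt_trans r0.
have lP := eproj_l2 ek FM.
have -> : series (fun i => oapp (fun n => gmf n * u n k * dot (u n) x) 0
    (pickle_inv i)) N = dot (eproj F ek) x.
  rewrite dot_eproj// /F big_filter /series /= /index_iota subn0 -big_pmap.
  rewrite [RHS]big_mkcond; apply: eq_bigr => n _; case: ifPn => nM.
    by rewrite (dotC _ ek) dot_basis.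
  by rewrite /gmf (negPf nM) !mul0r.
have -> : x k - dot (eproj F ek) x = dot (ek - eproj F ek) x.
  by rewrite dotBl// dot_basis.
rewrite -(@ltr_pXn2r _ 2) ?nnegrE ?(ltW e0)// real_normK ?num_real//.
have lw : l2r (ek - eproj F ek) by exact: l2rB.
apply: le_lt_trans (cauchy_schwarz lw lx) _.
have r20 : 0 < r ^+ 2 by rewrite exprn_gt0// (lt_trans _ r0).
rewrite -(ltr_pM2l r20) mulrA; apply: le_lt_trans (ler_wpM2r (nrm2_ge0 lx) hw) _.
apply: (@lt_le_trans _ _ (Z * nrm2 x + 1)); first by rewrite ltrDl.
rewrite -ler_pdivrMr//; apply: (@le_trans _ _ r); first by rewrite lerDl.
by rewrite expr2 ler_pMr ?(lt_trans _ r0)// ltW.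
Qed.

(* Krein's formula: the spectrum at [h2] off that at [h1] consists of the solutions
   of [m (s) = (h2 - h1)^-1], with [m] the Weyl function at [h1]. *)
Lemma krein_value (s : R) : (forall n, M n -> s != lam n) ->
  ~ rres a b g h2 s ->
  sums_along (@pickle_inv int) (fun n => gmf n / (lam n - s)) (h2 - h1)^-1.
Proof.
move=> sM ns; have [surj [C hC]] := res1 sM.
have le0 : l2r (basis 0 : nat -> R) by exact: l2r_basis.
have [psi hpsi] := surj _ le0; have [lpsi _] := rJh_l2 hpsi.
pose c := h2 - h1.
have c0 : c != 0 by rewrite subr_eq0 eq_sym.
(* Otherwise the rank one inversion formula would build the resolvent at [h2] from that at [h1]:
   with [p] the [h1]-solution, the [h2]-solution is [p + t *: psi], and the denominator
   [1 - c * psi 0] of [t] is nonzero. *)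
have h1c : c * psi 0%N = 1.
  apply: contrapT => /eqP; rewrite eq_sym -subr_eq0 => dn.
  apply: ns; split.
    move=> y ly; have [p hp] := surj _ ly.
    pose t := c * p 0%N / (1 - c * psi 0%N).
    exists (p + t *: psi); have := rJh_change h2 (rJh_lin t hp hpsi).
    congr (rJh _ _ _ _ _ _); rewrite -/c; apply/funext => n.
    rewrite !fctE /GRing.scale /=.
    have e : c * (p 0%N + t * psi 0%N) = t by rewrite /t; field.
    by rewrite e; ring.
  pose q := 1 - c * psi 0%N; rewrite -/q in dn.
  have C0 : 0 <= C.
    have h := hC _ _ hpsi; rewrite addrK in h.
    have z0 : 0 < nrm2 (basis 0 : nat -> R).
      by apply: (@nrm2_gt0 _ _ 0%N) => //; rewrite /basis eqxx oner_eq0.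
    by rewrite -(pmulr_lge0 _ z0) (le_trans (nrm2_ge0 lpsi) h).
  exists (C * (2 + 2 * (c / q) ^+ 2 * nrm2 psi)) => x y xy.
  have [lx ly] := rJh_l2 xy; have xy1 := rJh_change h1 xy.
  pose w := y - s *: x.
  have lw : l2r w by apply: l2rB => //; exact: l2rZ.
  have [p hp] := surj _ lw; have [lp _] := rJh_l2 hp.
  have bp := hC _ _ hp; rewrite addrK in bp.
  have e : x = p + (c * x 0%N) *: psi.
    apply/eqP; rewrite -subr_eq0; apply/eqP/nrm2_eq0.
      by apply: l2rB => //; apply: l2rD => //; exact: l2rZ.
    have := hC _ _ (rJhB xy1 (rJh_lin (c * x 0%N) hp hpsi)).
    rewrite (_ : _ - s *: _ = 0) ?nrm20 ?mulr0//.
    by apply/funext => n; rewrite /w /c !fctE /GRing.scale /= -[RHS]/(0 : R); ring.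
  have ex0 : x 0%N = p 0%N / q.
    have e0 : x 0%N = p 0%N + c * x 0%N * psi 0%N := congr1 (fun z => z 0%N) e.
    have : x 0%N * q = p 0%N by rewrite /q mulrBr mulr1 {1}e0; ring.
    by move=> <-; rewrite mulfK.
  have hx : nrm2 x <= 2 * nrm2 p + 2 * ((c * x 0%N) ^+ 2 * nrm2 psi).
    by rewrite {1}e; apply: le_trans (nrm2D_le lp (l2rZ _ lpsi)) _; rewrite nrm2Z.
  apply: le_trans hx _; rewrite -/w.
  have -> : (c * x 0%N) ^+ 2 = (c / q) ^+ 2 * p 0%N ^+ 2.
    by rewrite ex0; field.
  have f0 : 0 <= (c / q) ^+ 2 * nrm2 psi by rewrite mulr_ge0 ?sqr_ge0 ?nrm2_ge0.
  have k1 := ler_wpM2l f0 (coord_le 0 lp).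
  have k2 := ler_wpM2l f0 bp.
  by move: k1 k2; set A := _ ^+ 2; set B := nrm2 psi; lra.
(* [psi] is the resolvent at [s] applied to [basis 0], so its coefficient [dot (u n) psi] is
   [1 / (lam n - s)], and its entry at the origin is the Weyl function. *)
have := @eig_expansion s 0%N psi sM lpsi.
have -> : psi 0%N = (h2 - h1)^-1 by rewrite -[LHS](mulKf c0) h1c mulr1.
apply: eq_isums => n; have [Mn|nM] := pselect (M n); last first.
  by rewrite /gmf memNset// !mul0r.
rewrite u0// mulr1; congr (_ * _).
have ls : lam n - s != 0 by rewrite subr_eq0 eq_sym sM.
have lu := l2u Mn; have := dot_eig Mn hpsi.
rewrite (dotDr le0 (l2rZ _ lpsi) lu) dotZr// (dotC _ (basis 0)) dot_basis u0//.
move=> e; apply: (mulIf ls); rewrite mulVf// mulrBr ![dot _ _ * _]mulrC -e.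
by rewrite addrK.
Qed.

End Expansion.

(** * Enumeration of the spectra *)

Section Enumeration.
Context {R : realType}.
Implicit Types (M : set int) (x y : int -> R).

(** The clauses of the convention are exhaustive, although the first tests the infimum of [x] and
    the last two that of [y]: if [inf x] is finite then so is a negative [inf y], because
    [inf x <= inf y]. *)
Lemma enum_convention_shape M x y : enum_convention M x y ->
  [\/ M = setT, exists k, M = [set n | n <= k] | exists k, M = [set n | k <= n]].
Proof.
move=> [[xy _] [c1 c2 c3 c4 c5]].
have inf_le : (inf_on M x <= inf_on M y)%E.
  apply/ereal_infP => _ [n Mn <-]; apply: ge_ereal_inf; exists (x n)%:E.
    by exists n.
  by rewrite lee_fin ltW// xy.
have [s_top|s_fin] := eqVneq (sup_on M x) +oo%E; last first.
  have [s0|s0] := leP (sup_on M x) 0%E; first by apply: Or32; exists 0; exact: c3.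
  by have [|[k _ ->] _] := c2; [rewrite s0 ltey|apply: Or32; exists k].
have [i_bot|i_fin] := eqVneq (inf_on M x) -oo%E.
  by apply: Or31; case: (c1 i_bot s_top).
have [i0|i0] := leP 0%E (inf_on M y); first by apply: Or33; exists 0; exact: c4.
have [|[k _ ->] _] := c5; last by apply: Or33; exists k.
by rewrite i0 andbT (lt_le_trans _ inf_le)// ltNye.
Qed.

Lemma interlacing_order M x y : enum_convention M x y ->
  (forall m n, M m -> M n -> m <= n -> x m < y n) /\
  (forall m n, M m -> M n -> m < n -> y m < x n).
Proof.
move=> cxy; have conv m n k : M m -> M n -> m <= k <= n -> M k.
  by case: (enum_convention_shape cxy) => [->//|[l ->]|[l ->]] /=; lia.
have [[xy yx] _] := cxy.
have x_le m n : M m -> M n -> m <= n -> x m <= x n.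
  move=> Mm + mn; have -> : n = m + `|n - m|%N%:Z by lia.
  elim: `|n - m|%N => [|d IH] Mn; first by rewrite addr0.
  have Md : M (m + d%:Z) by apply: (conv m (m + d.+1%:Z)) => //; lia.
  apply: le_trans (IH Md) _; apply: ltW; apply: lt_trans (xy _ Md) _.
  have -> : m + d.+1%:Z = m + d%:Z + 1 by lia.
  by apply: yx => //; apply: (conv m (m + d.+1%:Z)) => //; lia.
split=> m n Mm Mn mn; first exact: le_lt_trans (x_le _ _ Mm Mn mn) (xy _ Mn).
have Mm1 : M (m + 1) by apply: (conv m n) => //; lia.
by apply: lt_le_trans (yx _ Mm Mm1) _; apply: x_le => //; lia.
Qed.

(** Without a last index, bounded increasing values would accumulate at their supremum, which is not
    attained and so, by the third hypothesis, stays at positive distance from all of them. With a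
    last index [k] the choice [K = k] is vacuous. *)
Lemma proper_up M x :
  (exists k, M = [set n | n <= k]) \/ (forall n, M n -> M (n + 1)) ->
  (forall m n, M m -> M n -> m < n -> x m < x n) ->
  (forall s, (forall n, M n -> s != x n) ->
     exists2 e, 0 < e & forall n, M n -> e <= `|x n - s|) ->
  forall L, exists K, forall n, M n -> K < n -> L < x n.
Proof.
move=> [[k ->] _ _ L|Mup mono iso L].
  by exists k => n /= nk kn; move: nk; rewrite leNgt kn.
apply: contrapT => noK.
have xL m : M m -> x m <= L.
  move=> Mm; apply: contrapT => /negP; rewrite -ltNge => Lx; apply: noK.
  by exists m => n Mn mn; apply: lt_trans Lx (mono _ _ Mm Mn mn).
have [n0 Mn0] : exists n, M n.
  by apply: contrapT => noM; apply: noK; exists 0 => n Mn; case: noM; exists n.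
pose S := [set x n | n in M].
have hS : has_sup S.
  by split; [exists (x n0), n0|exists L => _ [n Mn <-]; exact: xL].
have xS n : M n -> x n <= sup S.
  by move=> Mn; apply: ub_le_sup; [case: hS|exists n].
have [|e e0 he] := iso (sup S).
  move=> n Mn; rewrite gt_eqF//; apply: lt_le_trans (xS _ (Mup _ Mn)).
  by apply: mono => //; [exact: Mup|rewrite ltrDl].
have [_ [n Mn <-] xn] := sup_adherent e0 hS.
have := he _ Mn; rewrite leNgt => /negP; apply.
by rewrite ltr_norml; have h := xS _ Mn; apply/andP; split; lra.
Qed.

Lemma proper_enum M x :
  [\/ M = setT, exists k, M = [set n | n <= k] | exists k, M = [set n | k <= n]] ->
  (forall m n, M m -> M n -> m < n -> x m < x n) ->
  (forall s, (forall n, M n -> s != x n) ->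
     exists2 e, 0 < e & forall n, M n -> e <= `|x n - s|) ->
  forall r : R, exists K, forall n, M n -> (K < `|n|)%N -> r <= `|x n|.
Proof.
move=> shape mono iso r.
have [K1 hK1] : exists K, forall n, M n -> K < n -> r < x n.
  apply: (proper_up _ mono iso).
  case: shape => [->|[k ->]|[k ->]]; [by right|by left; exists k|right].
  by move=> n /=; lia.
have [K2 hK2] : exists K, forall n, M (- n) -> K < n -> r < - x (- n).
  apply: (@proper_up [set n | M (- n)] (fun n => - x (- n))).
  - case: shape => [->|[k ->]|[k ->]]; [by right|right|left; exists (- k)].
      by move=> n /=; lia.
    by apply/seteqP; split => n /=; lia.
  - by move=> m n Mm Mn mn; rewrite ltrN2; apply: mono => //; rewrite ltrN2.
  - move=> s hs; have [|e e0 he] := iso (- s).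
      move=> n Mn; have := hs (- n); rewrite /= opprK => /(_ Mn).
      by apply: contra => /eqP <-; rewrite opprK.
    exists e => // n Mn; have := he _ Mn.
    by rewrite opprK -normrN opprD.
exists (maxn `|K1| `|K2|)%N => n Mn Kn.
have [n0|n0] := leP 0 n.
  have := hK1 n Mn; have -> : K1 < n by lia.
  by move=> /(_ isT) h; rewrite (le_trans (ltW h))// ler_norm.
have := hK2 (- n); rewrite opprK => /(_ Mn); have -> : K2 < - n by lia.
by move=> /(_ isT) h; rewrite (le_trans (ltW h))// -normrN ler_norm.
Qed.

End Enumeration.

(** * From the spectral hypotheses to the expansion and the Krein sums *)

Section SpectralData.
Local Open Scope complex_scope.
Context {R : realType}.
Variables a b : nat -> R.
Hypothesis b_gt0 : forall n, 0 < b n.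
Variables (g : option R) (h1 h2 : R).
Hypothesis h12 : h1 <> h2.
Variables (M : set int) (lam nu gam : int -> R).
Hypothesis spec : enumerates_spectra a b g h1 h2 M lam nu.
Hypothesis gamP : forall n, M n -> norming_constant (Jhg a b g h1) (lam n) (gam n).

Lemma lam_neq_nu m n : M m -> M n -> lam m != nu n.
Proof.
move=> Mm Mn; case: spec => _ _; case: ifP => _ /interlacing_order[xy yx].
  have [mn|mn] := leP m n; first by rewrite lt_eqF// xy.
  by rewrite gt_eqF// yx.
have [mn|mn] := leP n m; first by rewrite gt_eqF// xy.
by rewrite lt_eqF// yx.
Qed.

Lemma lam_lt m n : M m -> M n -> m < n -> lam m < lam n.
Proof.
move=> Mm Mn mn; case: spec => _ _; case: ifP => _ /interlacing_order[xy yx].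
  by rewrite (lt_trans (xy _ _ Mm Mm _) (yx _ _ Mm Mn _)).
by rewrite (lt_trans (yx _ _ Mm Mn _) (xy _ _ Mn Mn _)).
Qed.

Lemma lam_neq m n : M m -> M n -> m != n -> lam m != lam n.
Proof.
move=> Mm Mn; case: ltgtP => // mn _; first by rewrite lt_eqF// lam_lt.
by rewrite gt_eqF// lam_lt.
Qed.

Let realC_inj (x y : R) : x%:C = y%:C -> x = y.
Proof. by case. Qed.

Lemma rres_lam s : (forall n, M n -> s != lam n) -> rres a b g h1 s.
Proof.
move=> sM; apply/resolventP; apply: contrapT => ns.
have : spectrum (Jhg a b g h1) s%:C by [].
case: spec => -> _ _ [n Mn /realC_inj e].
by have := sM _ Mn; rewrite e eqxx.
Qed.

Lemma rres_nu s : (forall n, M n -> s != nu n) -> rres a b g h2 s.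
Proof.
move=> sM; apply/resolventP; apply: contrapT => ns.
have : spectrum (Jhg a b g h2) s%:C by [].
case: spec => _ -> _ [n Mn /realC_inj e].
by have := sM _ Mn; rewrite e eqxx.
Qed.

Lemma nu_not_rres n : M n -> ~ rres a b g h2 (nu n).
Proof.
move=> Mn /resolventP.
suff : spectrum (Jhg a b g h2) (nu n)%:C by [].
by case: spec => _ -> _; exists n.
Qed.

Lemma spectral_data : exists u : int -> nat -> R,
  [/\ forall n, M n -> rJh a b g h1 (u n) (lam n *: u n),
      forall n, M n -> u n 0%N = 1,
      forall k x, l2r x -> sums_along (@pickle_inv int)
        (fun n => gam \_ M n * u n k * dot (u n) x) (x k) &
      forall j, M j -> sums_along (@pickle_inv int)
        (fun n => gam \_ M n / (lam n - nu j)) (h2 - h1)^-1].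
Proof.
have /choice[u hu] n : exists v, M n -> [/\ rJh a b g h1 v (lam n *: v),
    v 0%N = 1 & gam n = (nrm2 v)^-1].
  have [Mn|nM] := pselect (M n); last by exists 0.
  by have [v hv] := norming_constantP b_gt0 (gamP Mn); exists v.
have eig n : M n -> rJh a b g h1 (u n) (lam n *: u n) by move=> /hu[].
have u0 n : M n -> u n 0%N = 1 by move=> /hu[].
have gE n : gam \_ M n = gmf M u n.
  by rewrite /patch /gmf; case: ifPn => // /set_mem /hu[].
have shape : [\/ M = setT, exists k, M = [set n | n <= k] |
    exists k, M = [set n | k <= n]].
  by case: spec => _ _; case: ifP => _ /enum_convention_shape.
have [n0 Mn0] : exists n, M n.
  by case: shape => [->|[k ->]|[k ->]]; [exists 0|exists k => /=|exists k => /=].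
(* The lower bound at a resolvent point [s], tested on [u n], reads [1 <= C * (lam n - s) ^+ 2],
   which is impossible when [|lam n - s| < 1 / (|C| + 1)]. *)
have iso s : (forall n, M n -> s != lam n) ->
    exists2 e, 0 < e & forall n, M n -> e <= `|lam n - s|.
  move=> /rres_lam[_ [C hC]]; exists (`|C| + 1)^-1.
    by rewrite invr_gt0 ltr_wpDl.
  move=> n Mn; have [lu _] := rJh_l2 (eig _ Mn).
  have u_gt0 : 0 < nrm2 (u n).
    by apply: (@nrm2_gt0 _ _ 0%N) => //; rewrite u0// oner_eq0.
  have := hC _ _ (eig _ Mn); rewrite -scalerBl nrm2Z// mulrA.
  rewrite -{1}(mul1r (nrm2 _)) ler_pM2r// -(real_normK (num_real (lam n - s))).
  set d := `|_| => h; have d0 : 0 <= d by exact: normr_ge0.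
  rewrite leNgt; apply/negP; rewrite -[X in _ < X]mul1r ltr_pdivlMr ?ltr_wpDl// => h'.
  have h3 : 1 <= `|C| * d ^+ 2.
    by apply: le_trans h _; rewrite ler_wpM2r ?sqr_ge0// ler_norm.
  have C0 : 0 <= `|C| by [].
  have := mulr_ge0 d0 C0; have := mulr_ge0 (mulr_ge0 d0 C0) d0 => k1 k2.
  have d1 : d < 1 by lra.
  have := ler_wpM2l k2 (ltW d1); lra.
have proper := proper_enum shape lam_lt iso.
have h12' : h1 != h2 by apply/eqP.
have res2 n : M n -> rres a b g h2 (lam n).
  by move=> Mn; apply: rres_nu => m Mm; exact: lam_neq_nu.
have nuM j : M j -> forall n, M n -> nu j != lam n.
  by move=> Mj n Mn; rewrite eq_sym lam_neq_nu.
exists u; split => //.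
- move=> k x lx; have := eig_expansion b_gt0 h12' eig u0 lam_neq rres_lam res2
    proper (nuM _ Mn0) lx (k := k).
  by apply: eq_isums => n; rewrite gE.
- move=> j Mj; have := krein_value b_gt0 h12' eig u0 lam_neq rres_lam res2 proper
    (nuM _ Mj) (nu_not_rres Mj).
  by apply: eq_isums => n; rewrite gE.
Qed.

End SpectralData.

(** * Reconstruction of the coefficients and of the boundary condition *)

Section Reconstruction.
Context {R : realType}.
Local Notation isums := (sums_along (@pickle_inv int)).

Section ThreeTerm.
Variables (a b : nat -> R) (g : option R) (h : R) (M : set int).
Variables (lam gm : int -> R) (u : int -> nat -> R).
Hypothesis gm0 : forall n, ~ M n -> gm n = 0.
Hypothesis eig : forall n, M n -> rJh a b g h (u n) (lam n *: u n).
Hypothesis ortho : forall k j, isums (fun n => gm n * u n k * u n j) (k == j)%:R.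

Definition diag_coef k : R := a k - (if k == 0%N then h else 0).
(** The value 0 at [k = 0] multiplies the entry at [0.-1 = 0], so that one recurrence also covers
    the first row. *)
Definition lower_coef k : R := if k is k'.+1 then b k' else 0.

Lemma three_term n k : M n -> lam n * u n k =
  lower_coef k * u n k.-1 + diag_coef k * u n k + b k * u n k.+1.
Proof.
move=> /eig/rJh_tau/(congr1 (fun z => z k)).
case: k => [|k]; rewrite !fctE /GRing.scale /lower_coef /diag_coef /basis /= => ->.
  by ring.
by ring.
Qed.

(** The entries [u n k] are values at [lam n] of polynomials orthonormal for the weights [gm]; this
    is the classical formula for the diagonal coefficient as the integral of [x * p_k(x) ^+ 2]. *)
Lemma sums_diag k : isums (fun n => gm n * (lam n * u n k) * u n k) (diag_coef k).
Proof.
have := isumsD (isumsD (isumsZ (lower_coef k) (@ortho k.-1 k))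
  (isumsZ (diag_coef k) (@ortho k k))) (isumsZ (b k) (@ortho k.+1 k)).
rewrite eqxx mulr1 [_.+1 == _]gtn_eqF// mulr0n mulr0 addr0.
have -> : lower_coef k * (k.-1 == k)%:R = 0.
  by case: k => [|k] /=; rewrite ?mul0r// ltn_eqF// mulr0n mulr0.
rewrite add0r; apply: eq_isums => n.
have [Mn|/gm0 ->] := pselect (M n); last by rewrite !mul0r !mulr0 !addr0.
by rewrite three_term//; ring.
Qed.

Lemma sums_upper k : isums (fun n => gm n *
  (lam n * u n k - diag_coef k * u n k - lower_coef k * u n k.-1) ^+ 2) (b k ^+ 2).
Proof.
have := isumsZ (b k ^+ 2) (@ortho k.+1 k.+1); rewrite eqxx mulr1.
apply: eq_isums => n; have [Mn|/gm0 ->] := pselect (M n).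
  by rewrite three_term//; ring.
by rewrite !mul0r mulr0.
Qed.

End ThreeTerm.

(** At each level the two integrals involve only entries already identified. They give [a k] and
    [b k ^+ 2]; positivity then selects [b k], and dividing the recurrence by it identifies the next
    entries. *)
Lemma coefficients_unique (a b a' b' : nat -> R) (g g' : option R) (h : R)
    (M : set int) (lam gm : int -> R) (u u' : int -> nat -> R) :
  (forall n, 0 < b n) -> (forall n, 0 < b' n) ->
  (forall n, ~ M n -> gm n = 0) ->
  (forall n, M n -> rJh a b g h (u n) (lam n *: u n)) ->
  (forall n, M n -> rJh a' b' g' h (u' n) (lam n *: u' n)) ->
  (forall n, M n -> u n 0%N = 1) -> (forall n, M n -> u' n 0%N = 1) ->
  (forall k j, isums (fun n => gm n * u n k * u n j) (k == j)%:R) ->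
  (forall k j, isums (fun n => gm n * u' n k * u' n j) (k == j)%:R) ->
  [/\ a = a', b = b' & forall n, M n -> u n = u' n].
Proof.
move=> b_gt0 b'_gt0 gm0 eig eig' u0 u'0 ortho ortho'.
have step k : (forall n, M n -> u n k = u' n k) ->
    (forall n, M n -> lower_coef b k * u n k.-1 = lower_coef b' k * u' n k.-1) ->
    [/\ a k = a' k, b k = b' k & forall n, M n -> u n k.+1 = u' n k.+1].
  move=> uk lk.
  have ea : diag_coef a h k = diag_coef a' h k.
    apply: isums_unique (sums_diag gm0 eig ortho (k := k)) _.
    have := sums_diag gm0 eig' ortho' (k := k); apply: eq_isums => n.
    by have [/uk ->|/gm0 ->] := pselect (M n); rewrite ?mul0r.
  have eb : b k = b' k.
    apply/eqP; rewrite -(@eqrXn2 _ 2) ?ltW//; apply/eqP.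
    apply: isums_unique (sums_upper gm0 eig ortho (k := k)) _.
    have := sums_upper gm0 eig' ortho' (k := k); apply: eq_isums => n.
    have [Mn|/gm0 ->] := pselect (M n); last by rewrite !mul0r.
    by rewrite uk// lk// ea.
  split=> // [|n Mn]; first by move: ea; rewrite /diag_coef => /addIr.
  have := three_term eig k Mn; rewrite uk// lk// (three_term eig' k Mn) ea eb.
  move=> /addrI/mulfI -> //; first by rewrite gt_eqF.
have all_k k : [/\ forall n, M n -> u n k = u' n k,
    forall n, M n -> lower_coef b k * u n k.-1 = lower_coef b' k * u' n k.-1 &
    [/\ a k = a' k, b k = b' k & forall n, M n -> u n k.+1 = u' n k.+1]].
  elim: k => [|k [uk lk [ak bk uSk]]].
    have h0 n : M n -> u n 0%N = u' n 0%N by move=> Mn; rewrite u0// u'0.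
    have h1 n : M n -> lower_coef b 0 * u n 0.-1 = lower_coef b' 0 * u' n 0.-1.
      by rewrite !mul0r.
    by split => //; exact: step.
  have hl n : M n ->
      lower_coef b k.+1 * u n k.+1.-1 = lower_coef b' k.+1 * u' n k.+1.-1.
    by move=> Mn /=; rewrite bk uk.
  by split => //; exact: step.
split; [apply/funext => k|apply/funext => k|move=> n Mn; apply/funext => k].
- by case: (all_k k) => _ _ [].
- by case: (all_k k) => _ _ [].
- by case: (all_k k) => + _ _; exact.
Qed.

(** The solution [v] for the angle of [g] satisfies the condition [g]. Solving at [s] under the
    condition [g'] with the same right-hand side gives a vector with the same expansion
    coefficients, hence [v] itself. So [v] also satisfies [g'], and the constant Wronskian
    [b 0 * sin (al - be)] must be 0. *)
Lemma boundary_condition_unique (a b : nat -> R) (g g' : option R) (h s : R)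
    (M : set int) (lam gm : int -> R) (u : int -> nat -> R) :
  (forall n, 0 < b n) -> limit_circle_case a b ->
  (forall n, M n -> s != lam n) -> rres a b g' h s ->
  (forall n, M n -> rJh a b g h (u n) (lam n *: u n)) ->
  (forall n, M n -> rJh a b g' h (u n) (lam n *: u n)) ->
  (forall n, ~ M n -> gm n = 0) ->
  (forall k x, l2r x -> isums (fun n => gm n * u n k * dot (u n) x) (x k)) ->
  g = g'.
Proof.
move=> b_gt0 lc sM [surj _] eig eig' gm0 expan.
have [al hal] := angle_exists g.
pose v := v_ a b al; have dv : dmax a b v by exact: v_dmax.
have Jv : rJg a b g v (rtau a b v).
  right; split => //; exists al => //; apply: cvg_near_cst; apply: nearW => n.
  by rewrite wr_v// subrr sin0 mulr0.
have Tv : rJh a b g h v (rtau a b v - (h * v 0%N) *: basis 0).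
  by rewrite /rJh subrK.
set y := _ - _ in Tv; have [lv ly] := rJh_l2 Tv.
have lw : l2r (y - s *: v) by apply: l2rB => //; exact: l2rZ.
have [x Tx] := surj _ lw; have [lx _] := rJh_l2 Tx.
have dotE g0 z n : (forall n, M n -> rJh a b g0 h (u n) (lam n *: u n)) -> M n ->
    rJh a b g0 h z ((y - s *: v) + s *: z) ->
    dot (u n) z = dot (u n) (y - s *: v) / (lam n - s).
  move=> eg Mn Tz; have [lu _] := rJh_l2 (eg _ Mn); have [lz _] := rJh_l2 Tz.
  have ls : lam n - s != 0 by rewrite subr_eq0 eq_sym sM.
  have := dot_eig b_gt0 eg Mn Tz.
  rewrite (dotDr lw (l2rZ _ lz) lu) dotZr// => e.
  by apply: (mulIf ls); rewrite divfK// mulrBr ![dot _ z * _]mulrC -e addrK.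
have xv : x = v.
  apply/funext => k; apply: isums_unique (expan k x lx) _.
  have := expan k v lv; apply: eq_isums => n.
  have [Mn|/gm0 ->] := pselect (M n); last by rewrite !mul0r.
  rewrite (dotE _ _ _ eig' Mn Tx) (dotE _ _ _ eig Mn)//.
  by rewrite subrK.
have [[lp _]|[_ _ _ [be hbe hx]]] := Tx; first by case: lc.
rewrite xv in hx.
have : wr b (v_ a b be) v @ \oo --> b 0%N * sin (al - be).
  by apply: cvg_near_cst; apply: nearW => n; rewrite wr_v.
move=> /(cvg_unique (@Rhausdorff R) hx)/esym/eqP.
rewrite mulf_eq0 gt_eqF//= => /eqP sab.
have e := sinB_eq0 (angle_range hal) (angle_range hbe) sab.
by apply: angle_inj hal _; rewrite e.
Qed.

End Reconstruction.

Unset Implicit Arguments.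

Theorem theorem3p3 (R : realType) (a b a' b' : nat -> R)
    (b_gt0 : forall n, 0 < b n) (b'_gt0 : forall n, 0 < b' n)
    (g g' : option R)
    (discr : discrete_spectrum (Jg a b g))
    (discr' : discrete_spectrum (Jg a' b' g'))
    (h1 h2 : R) (h12 : h1 <> h2)
    (M : set int) (lam nu lam' nu' : int -> R)
    (spec : enumerates_spectra a b g h1 h2 M lam nu)
    (spec' : enumerates_spectra a' b' g' h1 h2 M lam' nu')
    (gam gam' : int -> R)
    (gamP : forall n, M n -> norming_constant (Jhg a b g h1) (lam n) (gam n))
    (gamP' : forall n, M n ->
      norming_constant (Jhg a' b' g' h1) (lam' n) (gam' n))
    (A : set int) (AM : A `<=` M)
    (eq_lam : forall n, M n -> lam n = lam' n)
    (eq_nu : forall n, (M `\` A) n -> nu n = nu' n)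
    (eq_gam : forall n, A n -> gam n = gam' n) :
  [/\ forall n, a n = a' n,
      forall n, b n = b' n &
      limit_circle_case a b -> g = g'].
Proof.
have [u [eig u0 expan krein]] := spectral_data b_gt0 h12 spec gamP.
have [u' [eig' u'0 expan' krein']] := spectral_data b'_gt0 h12 spec' gamP'.
have lb k : l2r (basis k : nat -> R) by exact: l2r_basis.
have ortho k j : sums_along (@pickle_inv int)
    (fun n => gam \_ M n * u n k * u n j) (k == j)%:R.
  have := expan k (basis j) (lb j); apply: eq_isums => n.
  by rewrite (dotC _ (basis j)) dot_basis.
have ortho' k j : sums_along (@pickle_inv int)
    (fun n => gam' \_ M n * u' n k * u' n j) (k == j)%:R.
  have := expan' k (basis j) (lb j); apply: eq_isums => n.
  by rewrite (dotC _ (basis j)) dot_basis.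
have off (f : int -> R) n : ~ M n -> (f \_ M) n = 0.
  by move=> nM; rewrite patchE memNset.
have mass : sums_along (@pickle_inv int) (gam \_ M) 1.
  have := ortho 0%N 0%N; apply: eq_isums => n.
  by have [/u0 ->|/off ->] := pselect (M n); rewrite ?mulr1 ?mul0r.
have mass' : sums_along (@pickle_inv int) (gam' \_ M) 1.
  have := ortho' 0%N 0%N; apply: eq_isums => n.
  by have [/u'0 ->|/off ->] := pselect (M n); rewrite ?mulr1 ?mul0r.
have gam_ge0 n : 0 <= (gam \_ M) n.
  have [Mn|/off ->//] := pselect (M n); rewrite patchE mem_set//.
  have [v [Tv _ ->]] := norming_constantP b_gt0 (gamP _ Mn).
  by rewrite invr_ge0 nrm2_ge0//; case: (rJh_l2 Tv).
have gam'_ge0 n : 0 <= (gam' \_ M) n.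
  have [Mn|/off ->//] := pselect (M n); rewrite patchE mem_set//.
  have [v [Tv _ ->]] := norming_constantP b'_gt0 (gamP' _ Mn).
  by rewrite invr_ge0 nrm2_ge0//; case: (rJh_l2 Tv).
pose d n := (gam \_ M) n - (gam' \_ M) n.
have d_off n : ~ (M `\` A) n -> d n = 0.
  rewrite /d; have [Mn nB|/[dup]/off -> /off ->] := pselect (M n); last first.
    by rewrite subrr.
  rewrite !patchE mem_set//; have [An|nA] := pselect (A n); last by case: nB.
  by rewrite eq_gam// subrr.
(* Both families are nonnegative of total mass 1, so their sum is the summable majorant required for
   the tail estimate. *)
have d_le n : `|d n| <= (gam \_ M) n + (gam' \_ M) n.
  by rewrite (le_trans (ler_normB _ _))// !ger0_norm.
have d_sum : sums_along (@pickle_inv int) d 0.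
  by have := isumsB mass mass'; rewrite subrr.
have d_nu j : (M `\` A) j ->
    sums_along (@pickle_inv int) (fun n => d n / (lam n - nu j)) 0.
  move=> Bj; have [Mj _] := Bj; have := isumsB (krein _ Mj) (krein' _ Mj).
  rewrite subrr; apply: eq_isums => n; rewrite /d mulrBl; congr (_ - _).
  have [Mn|/off ->] := pselect (M n); last by rewrite !mul0r.
  by rewrite -eq_lam// -eq_nu.
have BM : M `\` A `<=` M by move=> n [].
have d0 n : d n = 0.
  case: spec => _ _; case: ifP => _ /interlacing_order[xy yx].
    exact: (interlacing_uniqueness (@pickle_invK int) (@pickleK_inv int) BM xy yx
      d_off d_le (isumsD mass mass') d_sum d_nu).
  exact: (interlacing_uniqueness_rev (@pickle_invK int) (@pickleK_inv int) BM xy yx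
    d_off d_le (isumsD mass mass') d_sum d_nu).
have gamE : gam \_ M = gam' \_ M.
  by apply/funext => n; apply/eqP; rewrite -subr_eq0; apply/eqP/d0.
have {}eig' n : M n -> rJh a' b' g' h1 (u' n) (lam n *: u' n).
  by move=> Mn; rewrite eq_lam//; exact: eig'.
rewrite -gamE in ortho'.
have [ea eb eu] := coefficients_unique b_gt0 b'_gt0 (off gam) eig eig' u0 u'0
  ortho ortho'.
split=> [n|n|lc]; [by rewrite ea|by rewrite eb|].
(* The total mass 1 forces [M] to be nonempty; [nu n0] then serves as a real point outside the
   common spectrum of the two operators with [h1]. *)
have [n0 Mn0] : exists n, M n.
  apply: contrapT => noM; have M0 n : (gam \_ M) n = 0.
    by apply: off => Mn; apply: noM; exists n.
  have mass0 : sums_along (@pickle_inv int) (gam \_ M) 0.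
    have := isumsZ 0 mass; rewrite mul0r; apply: eq_isums => n.
    by rewrite M0 mul0r.
  by have := oner_neq0 R; rewrite (isums_unique mass mass0) eqxx.
subst a' b'.
have nuM n : M n -> nu n0 != lam n.
  by move=> Mn; rewrite eq_sym; exact: (lam_neq_nu spec Mn Mn0).
apply: (boundary_condition_unique b_gt0 lc nuM _ eig _ (off gam) expan).
  by apply: (rres_lam spec') => n Mn; rewrite -eq_lam// nuM.
by move=> n Mn; rewrite eu//; exact: eig'.
Qed.
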